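(* Let $\phi:X\to Y$ be a non-singular double cover, and let $(\mathcal{M}^{(k)},M^{(k)})$, $k=1,\dots,m$, be admissible pairs for $\phi$. For each $k$, let $(\{G_{ij}^{(k)}\},\{M_i^{(k)}\})_{\mathfrak{U}}$ be a good representation of $(\mathcal{M}^{(k)},M^{(k)})$ over a common affine open covering $\mathfrak{U}=\{U_i\}_{i\in I}$ of $Y$, where $$G_{ij}^{(k)}=\begin{pmatrix} g_{ij,11}^{(k)} & g_{ij,12}^{(k)} \\ g_{ij,21}^{(k)} & g_{ij,22}^{(k)} \end{pmatrix},\qquad M_i^{(k)}=\begin{pmatrix} a_{i0}^{(k)} & a_{i2}^{(k)} \\ a_{i1}^{(k)} & -a_{i0}^{(k)} \end{pmatrix}.$$ Put $G_{ij}^{(0)}:=\begin{pmatrix} 1 & 0 \\ 0 & \xi_{ij} \end{pmatrix}$, $M_i^{(0)}:=\begin{pmatrix} 0 & F_i \\ 1 & 0 \end{pmatrix}$ (the good representation of the admissible pair corresponding to $\mathcal{O}_X$), and for $k=1,\dots,m$ $$K_{ij}^{(k)+}:=\frac{1}{a_{i1}^{(k)}}\Big(\big(a_{i1}^{(k)}g_{ij,11}^{(k)}-a_{i0}^{(k)}g_{ij,21}^{(k)}\big)E+g_{ij,21}^{(k)}M_i^{(0)}\Big),$$ $$K_{ij}^{(k)-}:=\frac{\xi_{ij}}{a_{i1}^{(k)}\det(G_{ij}^{(k)})}\Big(\big(a_{i1}^{(k)}g_{ij,11}^{(k)}-a_{i0}^{(k)}g_{ij,21}^{(k)}\big)E-g_{ij,21}^{(k)}M_i^{(0)}\Big).$$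 Let $n_1,\dots,n_m$ be integers and $[n]:=[n_1,\dots,n_m]$. Then $\mathcal{L}^{[n]}:=\mathcal{L}_{(\mathcal{M}^{(1)},M^{(1)})}^{\otimes n_1}\otimes\cdots\otimes\mathcal{L}_{(\mathcal{M}^{(m)},M^{(m)})}^{\otimes n_m}$ is associated to the normal representation $(\{G_{ij}^{[n]}\},\{M_i^{[n]}\})_{\mathfrak{U}}$, where $$G_{ij}^{[n]}:=\left(K_{ij}^{(1)}(n_1)\right)^{|n_1|}\cdots\left(K_{ij}^{(m)}(n_m)\right)^{|n_m|}G_{ij}^{(0)},\qquad M_i^{[n]}:=M_i^{(0)},$$ with $K_{ij}^{(k)}(n_k):=K_{ij}^{(k)+}$ if $n_k\ge0$ and $K_{ij}^{(k)}(n_k):=K_{ij}^{(k)-}$ otherwise.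
   Context: All varieties are over $\mathbb{C}$. A non-singular double cover is a finite surjective morphism $\phi:X\to Y$ of degree $2$ between non-singular varieties. Let $B_\phi\subset Y$ be its branch locus, $R_\phi\subset X$ its ramification locus, and $F\in H^0(Y,\mathcal{O}_Y(B_\phi))$ a section defining $B_\phi$. There is a divisor $L$ on $Y$ with $2L\sim B_\phi$, $\phi_*\mathcal{O}_X\cong\mathcal{O}_Y\oplus\mathcal{O}_Y(-L)$ as $\mathcal{O}_Y$-modules, and $\phi_*\mathcal{O}_X\cong\big(\bigoplus_{n\ge0}t^n\mathcal{O}_Y(-nL)\big)/(t^2-F)$ as $\mathcal{O}_Y$-algebras, where $t$ corresponds to a section of $\mathcal{O}_X(R_\phi)$ defining $R_\phi$. $E$ is the $2\times2$ identity matrix. A 2-bundle is a vector bundle of rank $2$; $\mathcal{M}(-L):=\mathcal{M}\otimes\mathcal{O}_Y(-L)$. Admissible pairs: an admissible pair for $\phi$ is a pair $(\mathcal{M},M)$ of a 2-bundle $\mathcal{M}$ on $Y$ and a morphism $M:\mathcal{M}(-L)\to\mathcal{M}$ with $M^2=F\cdot\mathrm{id}_{\mathcal{M}}$, i.e. the composition $\mathcal{M}(-2L)\to\mathcal{M}(-L)\to\mathcal{M}$ of $M(-L)$ and $M$ is multiplication by $F$. Two pairs are equivalent, $(\mathcal{M},M)\sim(\mathcal{N},N)$, if there is an isomorphism $\Psi:\mathcal{M}\to\mathcal{N}$ with $\Psi\circ M=N\circ\Psi(-L)$. For a line bundle $\mathcal{L}$ on $X$, multiplication by $t$ gives $M_{\mathcal{L}}:\phi_*\mathcal{L}(-L)\to\phi_*\mathcal{L}$,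 and $[\mathcal{L}]\mapsto[(\phi_*\mathcal{L},M_{\mathcal{L}})]$ is a bijection $\Upsilon$ from $\operatorname{Pic}(X)$ to the set of equivalence classes of admissible pairs (known). $\mathcal{L}$ is associated to $(\mathcal{M},M)$ (or to a representation of it, defined next) if $\Upsilon([\mathcal{L}])=[(\mathcal{M},M)]$; such an $\mathcal{L}$ is denoted $\mathcal{L}_{(\mathcal{M},M)}$. Representations: let $\mathfrak{U}=\{U_i\}_{i\in I}$ be an affine open covering of $Y$ with $\phi_*\mathcal{O}_X|_{U_i}\cong\mathcal{O}_{U_i}\oplus\mathcal{O}_{U_i}t_i$ as algebras, $t_i:=t|_{U_i}$, and isomorphisms $\varphi_i:\mathcal{M}|_{U_i}\to\mathcal{O}_{U_i}^{\oplus2}$. Then $t_j=t_i\xi_{ij}$, where $\xi_{ij}\in\mathcal{O}_{U_i\cap U_j}^\times$ are the transition functions of $\mathcal{O}_Y(-L)$ (from $U_j$ to $U_i$), and $F_i:=F|_{U_i}=t_i^2$. Put $G_{ij}:=\varphi_i\circ\varphi_j^{-1}\in\mathrm{GL}(2,\mathcal{O}_{U_i\cap U_j})$ and let $M_i:=\varphi_i\circ M\circ(\varphi_i(-L))^{-1}=\begin{pmatrix} a_{i0} & a_{i2} \\ a_{i1} & -a_{i0} \end{pmatrix}$ be the matrix of $M$ on $U_i$; it satisfies $a_{i0}^2+a_{i1}a_{i2}=F_i$ and $M_j=\xi_{ij}G_{ij}^{-1}M_iG_{ij}$. Then $(\{G_{ij}\},\{M_i\})_{\mathfrak{U}}$ is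 a representation of $(\mathcal{M},M)$. It is good if every $a_{i1}$ is a unit on $U_i$, and normal if $M_i=\begin{pmatrix} 0 & F_i \\ 1 & 0 \end{pmatrix}$ for every $i$. *)

(* Defs.v *)
From HB Require Import structures.
From mathcomp Require Import all_boot all_order all_algebra.
From mathcomp Require Import all_classical reals topology.
From mathcomp Require Import complex.
From mathcomp Require mpoly.

Set Implicit Arguments.
Unset Strict Implicit.
Unset Printing Implicit Defensive.

Import GRing.Theory.
Local Open Scope classical_set_scope.
Local Open Scope ring_scope.

(* Varieties are taken in the classical sense: spaces of closed points with a
   sheaf of K-valued functions, locally isomorphic to Zariski closed subsets of
   affine spaces.  Over an algebraically closed field K this is the usual
   category of varieties. *)

(* lets [U x] be written for U : opens T below *)
Identity Coercion pred_of_set : set >-> Funclass.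

(* A sheaf of K-valued functions on T is the same thing as a local condition
   on germs of functions: [reg_at x f] means that f is regular at x, and the
   sections over an open U are the functions regular at every point of U.
   Only the germ of f at x matters, by [reg_near]. *)
Record fspace (K : fieldType) := FSpace {
  fs_top :> topologicalType;
  reg_at : fs_top -> set (fs_top -> K);
  reg_near : forall x (f g : fs_top -> K),
    (\forall y \near x, f y = g y) -> reg_at x f -> reg_at x g;
  reg_open : forall x f, reg_at x f -> \forall y \near x, reg_at y f;
  reg_cst : forall x (c : K), reg_at x (fun=> c);
  reg_sub : forall x f g,
    reg_at x f -> reg_at x g -> reg_at x (fun y => f y - g y);
  reg_mul : forall x f g,
    reg_at x f -> reg_at x g -> reg_at x (fun y => f y * g y);
  reg_inv : forall x f, reg_at x f -> f x != 0 ->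
    (\forall y \near x, f y != 0) /\ reg_at x (fun y => (f y)^-1)
}.

Definition reg_on (K : fieldType) (X : fspace K) (U : set X) (f : X -> K) : Prop :=
  forall x, U x -> reg_at x f.

Record opens (T : topologicalType) := Opens {
  oset :> set T;
  oset_open : open oset
}.

Definition opensI (T : topologicalType) (U V : opens T) : opens T :=
  Opens (openI (oset_open U) (oset_open V)).

Record fmorph (K : fieldType) (X Y : fspace K) := FMorph {
  fm :> X -> Y;
  fm_cont : continuous fm;
  fm_reg : forall x (g : Y -> K), reg_at (fm x) g -> reg_at x (g \o fm)
}.

Lemma opre_subproof (K : fieldType) (X Y : fspace K) (f : fmorph X Y)
  (V : opens Y) : open (f @^-1` V).
Proof.
by move/continuousP: (@fm_cont _ _ _ f); apply; exact: oset_open.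
Qed.

Definition opre (K : fieldType) (X Y : fspace K) (f : fmorph X Y)
  (V : opens Y) : opens X := Opens (@opre_subproof K X Y f V).

Section Varieties.
Variable K : fieldType.
Implicit Types X Y Z : fspace K.

Definition zero_locus (n : nat) (S : set (mpoly.mpoly n K)) : set ('I_n -> K) :=
  [set z | forall p, S p -> mpoly.meval z p = 0].

(* (U, O|_U) is isomorphic, through the coordinates z, to a Zariski closed
   subset of K^n with its Zariski topology and its regular functions. *)
Definition is_affine X (U : set X) : Prop :=
  open U /\
  exists (n : nat) (z : X -> 'I_n -> K) (S : set (mpoly.mpoly n K)),
  [/\ set_bij U (zero_locus S) z,
      (forall A : set X, A `<=` U ->
         (open A <-> exists S' : set (mpoly.mpoly n K),
            forall x, U x -> (A x <-> ~ zero_locus S' (z x)))) &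
      (forall x (f : X -> K), U x ->
         (reg_at x f <-> exists p q : mpoly.mpoly n K,
            mpoly.meval (z x) q != 0 /\
            \forall y \near x, f y = mpoly.meval (z y) p / mpoly.meval (z y) q))].

Definition irreducible_set (T : topologicalType) (A : set T) : Prop :=
  A !=set0 /\ forall C D : set T, closed C -> closed D ->
    A `<=` C `|` D -> A `<=` C \/ A `<=` D.

(* Hausdorff axiom for varieties: two morphisms from an affine variety agree
   on a closed set. *)
Definition separated X : Prop :=
  forall (Z : fspace K) (f g : fmorph Z X), is_affine [set: Z] ->
    closed [set z | f z = g z].

Definition is_variety X : Prop :=
  [/\ irreducible_set [set: X],
      (exists (n : nat) (U : 'I_n -> set X),
         (forall i, is_affine (U i)) /\ forall x, exists i, U i x) &
      separated X].

Definition has_chain (T : topologicalType) (d : nat) : Prop :=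
  exists Z : nat -> set T,
    (forall i, (i <= d)%N -> closed (Z i) /\ irreducible_set (Z i)) /\
    (forall i, (i < d)%N -> Z i `<` Z i.+1).

Definition krull_dim (T : topologicalType) (d : nat) : Prop :=
  has_chain T d /\ ~ has_chain T d.+1.

(* The local ring at x is regular: its maximal ideal is generated by as many
   elements as its dimension, which is that of X when X is a variety. *)
Definition nonsingular_at X (x : X) : Prop :=
  exists (d : nat) (g : 'I_d -> X -> K),
  [/\ krull_dim X d,
      (forall i, reg_at x (g i) /\ g i x = 0) &
      (forall h : X -> K, reg_at x h -> h x = 0 ->
         exists c : 'I_d -> X -> K, (forall i, reg_at x (c i)) /\
           \forall y \near x, h y = \sum_(i < d) c i y * g i y)].

Definition nonsingular X : Prop := forall x : X, nonsingular_at x.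

Definition finite_morph X Y (f : fmorph X Y) : Prop :=
  forall y : Y, exists V : set Y,
  [/\ V y, is_affine V, is_affine (f @^-1` V) &
      exists (n : nat) (g : 'I_n -> X -> K),
        (forall i, reg_on (f @^-1` V) (g i)) /\
        forall h : X -> K, reg_on (f @^-1` V) h ->
          exists c : 'I_n -> Y -> K, (forall i, reg_on V (c i)) /\
            forall x, V (f x) -> h x = \sum_(i < n) c i (f x) * g i x].

(* [K(X) : K(Y)] = d, for a dominant morphism f of irreducible varieties: the
   rational functions u_1, ..., u_d form a basis of K(X) over K(Y).  Rational
   functions are represented on nonempty open subsets. *)
Definition degree X Y (f : fmorph X Y) (d : nat) : Prop :=
  exists (U : opens X) (u : 'I_d -> X -> K),
  [/\ U !=set0, (forall i, reg_on U (u i)),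
      (forall (V : opens X) (h : X -> K), V !=set0 -> reg_on V h ->
         exists (W : opens Y) (c : 'I_d -> Y -> K),
         [/\ W !=set0, (forall i, reg_on W (c i)) &
             forall x, U x -> V x -> W (f x) ->
               h x = \sum_(i < d) c i (f x) * u i x]) &
      (forall (W : opens Y) (c : 'I_d -> Y -> K), W !=set0 ->
         (forall i, reg_on W (c i)) ->
         (forall x, U x -> W (f x) -> \sum_(i < d) c i (f x) * u i x = 0) ->
         forall i y, W y -> c i y = 0)].

Definition nonsingular_double_cover X Y (f : fmorph X Y) : Prop :=
  [/\ is_variety X /\ nonsingular X, is_variety Y /\ nonsingular Y,
      finite_morph f, (forall y, exists x, f x = y) & degree f 2].

(* m_{f(x)} generates the maximal ideal m_x of the local ring at x.  (Residue
   fields are all K, so no separability condition is needed.) *)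
Definition unramified_at X Y (f : fmorph X Y) (x : X) : Prop :=
  forall h : X -> K, reg_at x h -> h x = 0 ->
  exists (n : nat) (g : 'I_n -> Y -> K) (c : 'I_n -> X -> K),
  [/\ (forall i, reg_at (f x) (g i) /\ g i (f x) = 0),
      (forall i, reg_at x (c i)) &
      \forall y \near x, h y = \sum_(i < n) c i y * g i (f y)].

Definition ramification X Y (f : fmorph X Y) : set X :=
  [set x | ~ unramified_at f x].

Definition branch X Y (f : fmorph X Y) : set Y := f @` ramification f.

End Varieties.

Section RegularFunctions.
Variables (K : fieldType) (X : fspace K).
Implicit Types U V W : opens X.

Definition regular_pred U : {pred (set_type U -> K)} :=
  fun f => `[< exists2 g : X -> K, reg_on U g & forall x, f x = g (val x) >].

Lemma regular_pred_closed U : subring_closed (@regular_pred U).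
Proof.
split.
- by apply/asboolP; exists (fun=> 1) => // x _; exact: reg_cst.
- move=> f g /asboolP[f' rf ef] /asboolP[g' rg eg]; apply/asboolP.
  exists (fun y => f' y - g' y); first by move=> x Ux; apply: reg_sub; auto.
  by move=> x; rewrite -ef -eg.
- move=> f g /asboolP[f' rf ef] /asboolP[g' rg eg]; apply/asboolP.
  exists (fun y => f' y * g' y); first by move=> x Ux; apply: reg_mul; auto.
  by move=> x; rewrite -ef -eg.
Qed.

HB.instance Definition _ U :=
  GRing.isSubringClosed.Build _ (@regular_pred U) (@regular_pred_closed U).

Record oring U := ORing {
  ofun :> set_type U -> K;
  ofunP : ofun \in @regular_pred U
}.

HB.instance Definition _ U := [isSub for @ofun U].
HB.instance Definition _ U := [Choice of oring U by <:].
HB.instance Definition _ U :=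
  GRing.SubChoice_isSubComPzRing.Build _ _ (oring U) (@regular_pred_closed U).

Definition incl U V (h : V `<=` U) (x : set_type V) : set_type U :=
  SigSub (mem_set (h _ (set_valP x))).

Lemma ores_subproof U V (h : V `<=` U) (f : oring U) :
  (fun x => f (incl h x)) \in @regular_pred V.
Proof.
have /asboolP[g rg eg] := ofunP f; apply/asboolP; exists g => [x Vx|x].
  by apply: rg; exact: h.
by rewrite eg.
Qed.

Definition ores U V (h : V `<=` U) (f : oring U) : oring V :=
  ORing (ores_subproof h f).

Lemma oring_ext U (f g : oring U) : (forall x, f x = g x) -> f = g.
Proof. by move=> fg; apply/val_inj/funext. Qed.

Definition is_ounit U (f : oring U) : Prop := exists g : oring U, f * g = 1.

(* the inverse of a unit (and 0 on non-units) *)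
Definition oinv U (f : oring U) : oring U := xget 0 [set g : oring U | f * g = 1].

End RegularFunctions.

Section OModules.
Variables (K : fieldType) (X : fspace K).
Implicit Types U V W : opens X.

Record omod := OMod {
  sec : forall U : opens X, lmodType (oring U);
  res : forall U V, V `<=` U -> sec U -> sec V;
  resD : forall U V (h : V `<=` U) s s', res h (s + s') = res h s + res h s';
  resZ : forall U V (h : V `<=` U) a s, res h (a *: s) = ores h a *: res h s;
  res_id : forall U (h : U `<=` U) s, res h s = s;
  res_comp : forall U V W (h : V `<=` U) (h' : W `<=` V) (h'' : W `<=` U) s,
    res h' (res h s) = res h'' s;
  sec_sep : forall U (I : Type) (V : I -> opens X) (h : forall i, V i `<=` U),
    (forall x, U x -> exists i, V i x) ->
    forall s s' : sec U, (forall i, res (h i) s = res (h i) s') -> s = s';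
  sec_glue : forall U (I : Type) (V : I -> opens X) (h : forall i, V i `<=` U),
    (forall x, U x -> exists i, V i x) ->
    forall s : (forall i, sec (V i)),
    (forall i j W (hi : W `<=` V i) (hj : W `<=` V j),
       res hi (s i) = res hj (s j)) ->
    exists s' : sec U, forall i, res (h i) s' = s i
}.

Record ohom (A B : omod) := OHom {
  ohom_fun :> forall U, sec A U -> sec B U;
  ohom_linear : forall U, linear (@ohom_fun U);
  ohom_res : forall U V (h : V `<=` U) (s : sec A U),
    ohom_fun (res h s) = res h (ohom_fun s)
}.

Definition is_oiso (A B : omod) (f : ohom A B) : Prop :=
  exists g : ohom B A,
    (forall U (s : sec A U), g U (f U s) = s) /\
    (forall U (s : sec B U), f U (g U s) = s).

Definition oisom (A B : omod) : Prop := exists f : ohom A B, is_oiso f.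

Record obilin (A B C : omod) := OBilin {
  obil_fun :> forall U, sec A U -> sec B U -> sec C U;
  obil_linearr : forall U (s : sec A U), linear (obil_fun s);
  obil_linearl : forall U (t : sec B U), linear (fun s => obil_fun s t);
  obil_res : forall U V (h : V `<=` U) (s : sec A U) (t : sec B U),
    obil_fun (res h s) (res h t) = res h (obil_fun s t)
}.

(* universal property of b : (s, t) |-> s (x) t *)
Definition is_tensor (A B T : omod) (b : obilin A B T) : Prop :=
  forall (P : omod) (c : obilin A B P),
    (exists f : ohom T P, forall U s t, f U (b U s t) = c U s t) /\
    (forall f g : ohom T P,
       (forall U s t, f U (b U s t) = g U (b U s t)) ->
       forall U (x : sec T U), f U x = g U x).

Definition tensor_of (A B T : omod) : Prop :=
  exists b : obilin A B T, is_tensor b.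

(* an isomorphism A|_U -> O_U^n *)
Record triv (A : omod) (U : opens X) (n : nat) := Triv {
  triv_fun :> forall V, V `<=` U -> sec A V -> 'cV[oring V]_n;
  triv_linear : forall V (h : V `<=` U), linear (triv_fun h);
  triv_bij : forall V (h : V `<=` U), bijective (triv_fun h);
  triv_res : forall V W (h : V `<=` U) (h' : W `<=` V) (h'' : W `<=` U) s,
    triv_fun h'' (res h' s) = map_mx (ores h') (triv_fun h s)
}.

Definition vbundle (n : nat) (A : omod) : Prop :=
  forall x : X, exists U : opens X, U x /\ inhabited (triv A U n).

Definition line_bundle := vbundle 1.

(* e is a nowhere vanishing section, i.e. c |-> c e is an isomorphism O_U -> A|_U *)
Definition is_gen (A : omod) (U : opens X) (e : sec A U) : Prop :=
  forall V (h : V `<=` U) (s : sec A V),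
    exists! c : oring V, s = c *: res h e.

Lemma O_glue_subproof U (I : Type) (V : I -> opens X)
    (h : forall i, V i `<=` U) :
  (forall x, U x -> exists i, V i x) ->
  forall s : (forall i, oring (V i)),
  (forall i j W (hi : W `<=` V i) (hj : W `<=` V j),
     ores hi (s i) = ores hj (s j)) ->
  exists s' : oring U, forall i, ores (h i) s' = s i.
Proof.
move=> cov s agree.
have /choice[G GP] : forall i, exists g : X -> K,
    reg_on (V i) g /\ forall x, s i x = g (val x).
  by move=> i; have /asboolP[g rg eg] := ofunP (s i); exists g.
have GG i j x : V i x -> V j x -> G i x = G j x.
  move=> Vi Vj.
  have hi : opensI (V i) (V j) `<=` V i by move=> y [].
  have hj : opensI (V i) (V j) `<=` V j by move=> y [].
  have xI : x \in (opensI (V i) (V j) : set X) by apply/mem_set; split.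
  have /(congr1 (fun f : oring _ => f (SigSub xI))) /= := agree i j _ hi hj.
  by rewrite (GP i).2 (GP j).2.
have [i0|noI] := pselect (inhabited I); last first.
  have U0 : forall x, ~ U x.
    by move=> x /cov[i _]; apply: noI; exists.
  by exists 0 => i; case: noI; exists.
have {i0} [i0] := i0.
have /choice[ix ixP] : forall x, exists i, U x -> V i x.
  move=> x; have [/cov[i Vi]|nU] := pselect (U x); first by exists i.
  by exists i0.
pose g x := G (ix x) x.
have rg : (fun x : set_type U => g (val x)) \in @regular_pred _ _ U.
  apply/asboolP; exists g => // x Ux.
  have Vx := ixP _ Ux.
  apply: (@reg_near _ _ x (G (ix x))); last exact: (GP _).1.
  have := open_nbhs_nbhs (conj (oset_open (V (ix x))) Vx).
  apply: filterS => y Vy; apply: GG => //.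
  by apply: ixP; exact: h Vy.
exists (ORing rg) => i; apply: oring_ext => x /=.
rewrite (GP i).2 /g /=; apply: GG; last exact: set_valP.
by apply: ixP; apply: h; exact: set_valP.
Qed.

Definition O_mod : omod.
Proof.
refine (@OMod (fun U => (oring U)^o) (fun U V h s => ores h s) _ _ _ _ _ _).
- by move=> *; apply: oring_ext.
- by move=> *; apply: oring_ext.
- move=> U h s; apply: oring_ext => x /=; congr (ofun s _).
  exact/val_inj.
- move=> U V W h h' h'' s; apply: oring_ext => x /=; congr (ofun s _).
  exact/val_inj.
- move=> U I V h cov s s' ss'; apply: oring_ext => x.
  have [i Vi] := cov _ (set_valP x).
  have /(congr1 (fun f : oring _ => f (SigSub (mem_set Vi)))) /= := ss' i.
  by rewrite (_ : incl _ _ = x)//; exact/val_inj.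
- by move=> U I V h cov s; exact: O_glue_subproof.
Defined.

(* Tensor products are only determined up to isomorphism, so that tensor
   powers and products are relations: T is one of them. *)
Fixpoint tensor_exp (A : omod) (n : nat) (T : omod) : Prop :=
  match n with
  | 0%N => oisom T O_mod
  | n'.+1 => exists P, tensor_exp A n' P /\ tensor_of P A T
  end.

(* the inverse in Pic(X) *)
Definition inverse_of (A B : omod) : Prop :=
  line_bundle B /\ tensor_of B A O_mod.

(* [Negz n'] is the integer -(n'+1) *)
Definition tensor_zexp (A : omod) (n : int) (T : omod) : Prop :=
  match n with
  | Posz n' => tensor_exp A n' T
  | Negz n' => exists B, inverse_of A B /\ tensor_exp B n'.+1 T
  end.

Fixpoint tensor_prod (m : nat) : ('I_m -> omod) -> omod -> Prop :=
  match m with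
  | 0%N => fun _ T => oisom T O_mod
  | m'.+1 => fun A T => exists P,
      tensor_prod (fun k : 'I_m' => A (widen_ord (leqnSn m') k)) P /\
      tensor_of P (A ord_max) T
  end.

(* T is a tensor product A_1^{n_1} (x) ... (x) A_m^{n_m} *)
Definition tensor_monomial (m : nat) (A : 'I_m -> omod) (n : 'I_m -> int)
    (T : omod) : Prop :=
  exists B : 'I_m -> omod,
    (forall k, tensor_zexp (A k) (n k) (B k)) /\ tensor_prod B T.

End OModules.

Section DirectImage.
Variables (K : fieldType) (X Y : fspace K) (f : fmorph X Y).

Definition fpoint (V : opens Y) (x : set_type (opre f V)) : set_type V :=
  SigSub (@mem_set _ (V : set Y) (f (val x)) (set_valP x)).

Lemma opull_subproof (V : opens Y) (a : oring V) :
  (fun x : set_type (opre f V) => a (fpoint x))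
    \in @regular_pred _ _ (opre f V).
Proof.
have /asboolP[g rg eg] := ofunP a; apply/asboolP.
exists (g \o f) => [x Vx|x]; first by apply: fm_reg; exact: rg.
by rewrite eg.
Qed.

Definition opull (V : opens Y) (a : oring V) : oring (opre f V) :=
  ORing (opull_subproof a).

Lemma opullD V (a b : oring V) : opull (a + b) = opull a + opull b.
Proof. exact: oring_ext. Qed.

Lemma opullM V (a b : oring V) : opull (a * b) = opull a * opull b.
Proof. exact: oring_ext. Qed.

Lemma opull1 V : opull (1 : oring V) = 1.
Proof. exact: oring_ext. Qed.

Definition push_sec (A : omod X) (V : opens Y) : Type := sec A (opre f V).

HB.instance Definition _ A V :=
  GRing.Zmodule.copy (push_sec A V) (sec A (opre f V)).

Section PushLmod.
Variables (A : omod X) (V : opens Y).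

Definition push_scale (a : oring V) (s : push_sec A V) : push_sec A V :=
  opull a *: (s : sec A (opre f V)).

Lemma push_scaleA a b s : push_scale a (push_scale b s) = push_scale (a * b) s.
Proof. by rewrite /push_scale scalerA opullM. Qed.

Lemma push_scale1 : left_id 1 push_scale.
Proof. by move=> s; rewrite /push_scale opull1 scale1r. Qed.

Lemma push_scaleDr : right_distributive push_scale +%R.
Proof. by move=> a s s'; rewrite /push_scale scalerDr. Qed.

Lemma push_scaleDl s : {morph push_scale^~ s : a b / a + b}.
Proof. by move=> a b; rewrite /push_scale opullD scalerDl. Qed.

HB.instance Definition _ := GRing.Zmodule_isLmodule.Build (oring V)
  (push_sec A V) push_scaleA push_scale1 push_scaleDr push_scaleDl.
End PushLmod.

Lemma opre_sub (U V : opens Y) : V `<=` U -> opre f V `<=` opre f U.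
Proof. by move=> h x /= /h. Qed.

Definition push (A : omod X) : omod Y.
Proof.
refine (@OMod _ Y (fun V => push_sec A V)
  (fun U V h (s : push_sec A U) => (res (opre_sub h) s : push_sec A V))
  _ _ _ _ _ _).
- by move=> U V h s s'; exact: resD.
- move=> U V h a s.
  have e : ores (opre_sub h) (opull a) = opull (ores h a).
    by apply: oring_ext => x /=; congr (ofun a _); exact/val_inj.
  change (res (opre_sub h) (opull a *: (s : sec A (opre f U))) =
    opull (ores h a) *: res (opre_sub h) (s : sec A (opre f U))).
  by rewrite resZ e.
- by move=> U h s; exact: res_id.
- by move=> U V W h h' h'' s; exact: res_comp.
- move=> U I V h cov s s'; apply: (@sec_sep _ _ A _ I (fun i => opre f (V i))).
  by move=> x /cov.
- move=> U I V h cov s agree.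
  apply: (@sec_glue _ _ A _ I (fun i => opre f (V i)) (fun i => opre_sub (h i))).
    by move=> x /cov.
  move=> i j W hi hj.
  have ki : opensI (V i) (V j) `<=` V i by move=> y [].
  have kj : opensI (V i) (V j) `<=` V j by move=> y [].
  have hW : W `<=` opre f (opensI (V i) (V j)).
    by move=> x Wx; split; [exact: hi|exact: hj].
  have := agree i j _ ki kj.
  move=> /(congr1 (res hW)).
  by rewrite (res_comp _ _ hi) (res_comp _ _ hj).
Defined.

End DirectImage.

(* The data attached to a double cover f.  [dL] is O_Y(-L), [dL2] is O_Y(-2L),
   and F, as a section of O_Y(2L), is a morphism O_Y(-2L) -> O_Y.  The
   morphism [dt] : e |-> t e, from O_Y(-L) to f_* O_X, gives f_* O_X as the
   O_Y-algebra O_Y (+) t O_Y(-L) with t^2 = F. *)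
Record cover_data (K : fieldType) (X Y : fspace K) (f : fmorph X Y) := CoverData {
  dL : omod Y;
  dL_line : line_bundle dL;
  dL2 : omod Y;
  dsq : obilin dL dL dL2;
  dsq_tensor : is_tensor dsq;
  dF : ohom dL2 (O_mod Y);
  (* F is an isomorphism of O_Y(-2L) onto the ideal sheaf O_Y(-B) of the
     branch locus: 2L ~ B, and F is a section of O_Y(B) defining B *)
  dF_branch : forall (V : opens Y) (h : oring V),
    (forall y : set_type V, branch f (val y) -> h y = 0) <->
    (exists! w : sec dL2 V, dF V w = h);
  dt : ohom dL (push f (O_mod X));
  dt_split : forall (V : opens Y) (h : oring (opre f V)),
    exists! ae : oring V * sec dL V,
      h = opull f ae.1 + (dt V ae.2 : oring (opre f V));
  dt_sqr : forall (V : opens Y) (e e' : sec dL V),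
    (dt V e : oring (opre f V)) * (dt V e' : oring (opre f V)) =
    opull f (dF V (dsq V e e') : oring V);
  (* t, as a section of f^* O_Y(L), defines the ramification locus *)
  dt_ram : forall (V : opens Y) (e : sec dL V), is_gen e ->
    forall (W : opens X) (k : W `<=` opre f V) (h : oring W),
    (forall x : set_type W, ramification f (val x) -> h x = 0) <->
    (exists h' : oring W, h = ores k (dt V e : oring (opre f V)) * h')
}.

Section AdmissiblePairs.
Variables (K : fieldType) (X Y : fspace K) (f : fmorph X Y) (D : cover_data f).

(* (M, M : M(-L) -> M), together with the tensor product M(-L) = M (x) O_Y(-L) *)
Record pair := Pair {
  pbun : omod Y;
  ptwist : omod Y;
  ptens : obilin pbun (dL D) ptwist;
  pmap : ohom ptwist pbun
}.

Definition Fval (V : opens Y) (e e' : sec (dL D) V) : oring V :=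
  dF D V (dsq D V e e').

Definition admissible (p : pair) : Prop :=
  [/\ vbundle 2 (pbun p), is_tensor (ptens p) &
      forall (V : opens Y) (s : sec (pbun p) V) (e e' : sec (dL D) V),
        pmap p V (ptens p V (pmap p V (ptens p V s e)) e') = Fval e e' *: s].

Definition pair_equiv (p q : pair) : Prop :=
  exists Psi : ohom (pbun p) (pbun q), is_oiso Psi /\
    forall (V : opens Y) (s : sec (pbun p) V) (e : sec (dL D) V),
      Psi V (pmap p V (ptens p V s e)) = pmap q V (ptens q V (Psi V s) e).

(* p is the pair (f_* A, M_A), where M_A is the multiplication by t *)
Variant is_Upsilon (A : omod X) : pair -> Prop :=
  IsUpsilon (T : omod Y) (b : obilin (push f A) (dL D) T)
    (MA : ohom T (push f A)) of is_tensor b &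
    (forall (V : opens Y) (s : sec A (opre f V)) (e : sec (dL D) V),
       MA V (b V s e) = (dt D V e : oring (opre f V)) *: s) :
  is_Upsilon A (Pair b MA).

Definition associated (A : omod X) (p : pair) : Prop :=
  line_bundle A /\ exists q, is_Upsilon A q /\ pair_equiv q p.

(* An affine open covering U_i of Y with generators e_i of O_Y(-L) on U_i; then
   t_i = t e_i generates the second summand of f_* O_X on U_i. *)
Record adapted_cover (I : Type) := AdaptedCover {
  acov :> I -> opens Y;
  acov_affine : forall i, is_affine (acov i);
  acov_cover : forall y : Y, exists i, acov i y;
  agen : forall i, sec (dL D) (acov i);
  agen_gen : forall i, is_gen (agen i);
  axi : forall i j, oring (opensI (acov i) (acov j));
  axi_trans : forall i j (hi : opensI (acov i) (acov j) `<=` acov i)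
    (hj : opensI (acov i) (acov j) `<=` acov j),
    res hj (agen j) = axi i j *: res hi (agen i)
}.

Definition mx2 (S : Type) (a b c d : S) : 'M[S]_2 :=
  \matrix_(i, j) if i == 0 then (if j == 0 then a else b)
                 else (if j == 0 then c else d).

Section Representations.
Variables (I : Type) (U : adapted_cover I).

Local Notation U2 i j := (opensI (acov U i) (acov U j)).

Definition gluing := forall i j : I, 'M[oring (U2 i j)]_2.
Definition local_mx := forall i : I, 'M[oring (U i)]_2.

(* G_ij = phi_i o phi_j^-1, and M_i = phi_i o M o phi_i(-L)^-1, where phi_i(-L)
   is phi_i tensored with the trivialization of O_Y(-L) given by e_i *)
Definition is_rep (p : pair) (G : gluing) (M : local_mx) : Prop :=
  exists phi : forall i, triv (pbun p) (U i) 2,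
    (forall i j (W : opens Y) (hi : W `<=` U i) (hj : W `<=` U j)
       (hij : W `<=` U2 i j) (s : sec (pbun p) W),
       phi i W hi s = map_mx (ores hij) (G i j) *m phi j W hj s) /\
    (forall i (W : opens Y) (h : W `<=` U i) (s : sec (pbun p) W),
       phi i W h (pmap p W (ptens p W s (res h (agen U i)))) =
       map_mx (ores h) (M i) *m phi i W h s).

(* F_i, which is t_i^2 by [dt_sqr] *)
Definition Floc (i : I) : oring (U i) := Fval (agen U i) (agen U i).

Definition M0 : local_mx := fun i => mx2 0 (Floc i) 1 0.
Definition G0 : gluing := fun i j => mx2 1 0 0 (axi U i j).

Definition resl (i j : I) : oring (U i) -> oring (U2 i j) :=
  @ores _ _ (U i) (U2 i j) (@subIsetl _ (U i) (U j)).

Definition Kplus (G : gluing) (a0 a1 : forall i, oring (U i)) : gluing :=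
  fun i j =>
    let g11 := G i j 0 0 in let g21 := G i j 1 0 in
    let b0 := resl j (a0 i) in let b1 := resl j (a1 i) in
    oinv b1 *: ((b1 * g11 - b0 * g21) *: 1%:M
                + g21 *: map_mx (resl j) (M0 i)).

Definition Kminus (G : gluing) (a0 a1 : forall i, oring (U i)) : gluing :=
  fun i j =>
    let g11 := G i j 0 0 in let g21 := G i j 1 0 in
    let b0 := resl j (a0 i) in let b1 := resl j (a1 i) in
    (axi U i j * oinv (b1 * \det (G i j))) *:
      ((b1 * g11 - b0 * g21) *: 1%:M - g21 *: map_mx (resl j) (M0 i)).

Definition Kn (G : gluing) (a0 a1 : forall i, oring (U i)) (n : int) : gluing :=
  if 0 <= n then Kplus G a0 a1 else Kminus G a0 a1.

Definition Gn (m : nat) (G : 'I_m -> gluing)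
    (a0 a1 : 'I_m -> forall i, oring (U i)) (n : 'I_m -> int) : gluing :=
  fun i j =>
    (\prod_(k < m) (Kn (G k) (a0 k) (a1 k) (n k) i j) ^+ `|n k|%N) *m G0 i j.

End Representations.
End AdmissiblePairs.

(* Main.v *)
Require Import Defs.
From HB Require Import structures.
From mathcomp Require Import all_boot all_order all_algebra.
From mathcomp Require Import all_classical reals topology.
From mathcomp Require Import complex.
From mathcomp Require Import finmap constructive_ereal ring.
From mathcomp Require mpoly lebesgue_measure.

(** A good representation says that the section s_i of L^(k) with coordinates
(1, 0) on U_i and its multiple t_i s_i form a basis of the direct image over
U_i, so s_i generates the direct image as a module over the direct image of
O_X.  As L^(k) is globally generated on affine open sets, s_i then vanishes
nowhere on the inverse image of U_i, hence trivializes L^(k) there.  The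
transition functions u_ij, defined by s_j = u_ij s_i, are read off the first
column of G_ij, and K^+ is the matrix of the multiplication by u_ij in the
basis 1, t_i of the direct image of O_X.  The matrix K^- is that of
u_ij^-1 a_j1 / a_i1, a cocycle of the inverse of L^(k) with respect to the
generators a_i1 s_i^-1.  Products of cocycles thus correspond to products of
matrices, and the factor G^(0) accounts for t_j = xi_ij t_i. *)

Import -(notations) mpoly.
Import GRing.Theory.

Set Implicit Arguments.
Unset Strict Implicit.
Unset Printing Implicit Defensive.

Local Open Scope classical_set_scope.
Local Open Scope ring_scope.

(** * The Nullstellensatz over an uncountable field *)

Section Uncountable.
Import Order.TTheory Num.Theory.

(** An affine open set is known only through local data: its regular functions are locally quotients
    of polynomials. Global statements over it are obtained from ideals: the polynomials u for which
    the statement holds over D(u), or those that serve as denominators, form an ideal, and a common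
    zero of it would contradict what is known near that point. The Nullstellensatz behind this is
    proved by a dimension count over an uncountable field, which covers the complex numbers.

    Global generation is called for because the basis s_i, t_i s_i concerns only sections over
    inverse images of open sets of Y, whereas a generator must work over every open set of X.

    The factor in K^- comes from a norm. Changing the sign of t_i conjugates a_i1 u_ij, and M_j =
    xi_ij G_ij^-1 M_i G_ij shows that xi_ij times the norm of a_i1 u_ij equals a_i1 a_j1 det(G_ij).
    Inverting u_ij thus divides by a_j1; the coboundary a_j1 / a_i1 turns this into a division by
    a_i1. *)

Lemma uncountable_complex (R : realType) : ~ countable [set: R[i]].
Proof.
move=> cC; have cR : countable [set: R].
  have /countable_injP[f injf] := cC; apply/countable_injP.
  exists (fun x => f x%:C%C) => x y _ _ /injf fxy.
  by have := fxy (mem_set I) (mem_set I); case.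
have c01 : countable (`[0, 1]%classic : set R).
  by apply: sub_countable cR; exact: subset_card_le.
have := lebesgue_measure.countable_lebesgue_measure0 c01.
rewrite lebesgue_measure.lebesgue_measure_itv /= lte_fin ltr01.
rewrite oppr0 addr0 => /eqP; rewrite gt_eqF// lte_fin ltr01.
Qed.

End Uncountable.

(** A countable union of finite fibres would be countable. The map to which this is applied records
    a list of monomials and an exponent, which form a countable type. *)
Lemma infinite_fiber (T : choiceType) (S : countType) (f : T -> S) :
  ~ countable [set: T] -> exists s, infinite_set (f @^-1` [set s]).
Proof.
move=> uT; apply: contrapT => fin; apply: uT.
have -> : [set: T] = \bigcup_(s in [set: S]) (f @^-1` [set s]).
  by apply/seteqP; split=> // x _; exists (f x).
apply: bigcup_countable => // s _; apply: finite_set_countable.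
by apply: contrapT => nf; apply: fin; exists s.
Qed.

Definition is_ideal (A : comPzRingType) (J : set A) :=
  [/\ J 0, forall p q, J p -> J q -> J (p + q) & forall p q, J q -> J (p * q)].

Section Nullstellensatz.
Variables (K : closedFieldType) (n : nat).
Hypothesis uncountableK : ~ countable [set: K].
Local Notation A := (mpoly n K).

(** [P] plays the role of a maximal ideal of the localization at [H]: the last clause says that
    every element outside [P] becomes invertible modulo [P] once [H] is inverted. Working with
    powers of [H] avoids both a ring of fractions and the extra variable of Rabinowitsch. *)
Lemma maximal_avoiding_ideal (B : comPzRingType) (J : set B) (H : B) :
  is_ideal J -> (forall N, ~ J (H ^+ N)) ->
  exists P : set B, [/\ is_ideal P, J `<=` P, forall N, ~ P (H ^+ N) &
    forall a, ~ P a -> exists w N, P (a * w - H ^+ N)].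
Proof.
move=> idJ JH.
(* Zorn's lemma also tests the empty chain, whose union is empty; the guard [Q !=set0] lets it pass.
   The maximal element is nonempty all the same, since otherwise [J] would be larger. *)
pose good (Q : set B) := Q !=set0 ->
  [/\ is_ideal Q, J `<=` Q & forall N, ~ Q (H ^+ N)].
have [|P [gP maxP]] := @Zorn_bigcup _ good.
  move=> F Fg Ftot [p0 [Q0 FQ0 Qp0]].
  have Fne Q p : F Q -> Q p -> [/\ is_ideal Q, J `<=` Q & forall N, ~ Q (H ^+ N)].
    by move=> FQ Qp; apply: Fg => //; exists p.
  have [[i00 i0D i0M] JQ0 Q0H] := Fne _ _ FQ0 Qp0.
  split; last first.
  - by move=> N [Q FQ QH]; have [_ _ /(_ N)] := Fne _ _ FQ QH.
  - by move=> p Jp; exists Q0 => //; exact: JQ0.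
  split; first by exists Q0.
  - move=> p q [Q1 F1 Q1p] [Q2 F2 Q2q].
    have [[_ D1 _] _ _] := Fne _ _ F1 Q1p; have [[_ D2 _] _ _] := Fne _ _ F2 Q2q.
    have [s|s] := Ftot _ _ F1 F2.
      by exists Q2 => //; apply: D2 => //; exact: s.
    by exists Q1 => //; apply: D1 => //; exact: s.
  - move=> p q [Q FQ Qq]; have [[_ _ QM] _ _] := Fne _ _ FQ Qq.
    by exists Q => //; exact: QM.
have neP : P !=set0.
  apply: contrapT => P0; apply: (maxP J) => [|_]; last by split.
  split; first by move=> p Pp; case: P0; exists p.
  by move=> sJ; apply: P0; exists 0; apply: sJ; case: idJ.
have [idP JP PH] := gP neP; have [P0 PD PM] := idP.
exists P; split=> // a nPa; apply: contrapT => nw.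
pose Q := [set b | exists p w, P p /\ b = p + a * w].
have PQ : P `<=` Q by move=> p Pp; exists p, 0; rewrite mulr0 addr0.
apply: (maxP Q).
  by split=> // /(_ a) Pa; apply/nPa/Pa; exists 0, 1; rewrite mulr1 add0r.
move=> _; split; last first.
- move=> N [p [w [Pp HE]]]; apply: nw; exists w, N.
  by rewrite (_ : _ - _ = -1 * p); [exact: PM | rewrite HE; ring].
- by move=> p /JP /PQ.
split; first exact: PQ.
- move=> _ _ [p [w [Pp ->]]] [q [v [Pq ->]]]; exists (p + q), (w + v).
  by split; [exact: PD | ring].
- move=> b _ [p [w [Pp ->]]]; exists (b * p), (b * w).
  by split; [exact: PM | ring].
Qed.

Section Prime.
Variables (P : set A) (H : A).
Hypotheses (idP : is_ideal P) (PH : forall N, ~ P (H ^+ N)).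
Hypothesis Pmax : forall a, ~ P a -> exists w N, P (a * w - H ^+ N).

Let P0 : P 0. Proof. by case: idP. Qed.
Let PD p q : P p -> P q -> P (p + q). Proof. by case: idP => _ + _; apply. Qed.
Let PM p q : P q -> P (p * q). Proof. by case: idP => _ _; apply. Qed.

(** If neither factor were in [P], then modulo [P] multiples of [a] and of [b] would be powers of
    [H], and so would a multiple of their product. *)
Lemma avoiding_ideal_prime a b : P (a * b) -> P a \/ P b.
Proof.
move=> Pab; apply: contrapT => /not_orP[/Pmax[w [N Pw]] /Pmax[v [M Pv]]].
apply: (PH (N := N + M)).
rewrite (_ : H ^+ _ = (w * v) * (a * b) + (- H ^+ M) * (a * w - H ^+ N) +
  (- (a * w)) * (b * v - H ^+ M)); last by rewrite exprD; ring.
by apply: PD; [apply: PD|]; exact: PM.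
Qed.

Lemma ideal_sum (T : Type) (r : seq T) (F : T -> A) :
  (forall i, P (F i)) -> P (\sum_(i <- r) F i).
Proof. by move=> PF; elim/big_ind: _. Qed.

(* Otherwise every theta - a is invertible modulo P up to a power of H; as K is
   uncountable, finitely many of these inverses are linearly dependent, which
   gives a polynomial relation satisfied by theta modulo P. *)
Lemma residue_scalar (theta : A) : exists rho : K, P (theta - rho%:A).
Proof.
apply: contrapT => nrho.
have /choice[wN wNP] : forall a : K, exists wN : A * nat,
    P ((theta - a%:A) * wN.1 - H ^+ wN.2).
  move=> a; have [|w [N PwN]] := Pmax (a := theta - a%:A).
    by move=> Pa; apply: nrho; exists a.
  by exists (w, N).
(* Infinitely many scalars share the support [ms] and the exponent [N]; their inverses lie in the
   span of the [k] monomials of [ms], so any [k.+1] of them are linearly dependent. *)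
have [[ms N] inf] := infinite_fiber (fun a : K => (msupp (wN a).1, (wN a).2))
  uncountableK.
have [B Bsub szB] := infinite_set_fset (size ms).+1 inf.
set k := size ms in szB.
have BsE (b : K) : b \in B -> msupp (wN b).1 = ms /\ (wN b).2 = N.
  by move=> bB; have /= := Bsub b bB; case=> -> ->.
pose x (i : 'I_k.+1) := nth 0 B i.
have xB i : x i \in B by apply: mem_nth; exact: leq_trans (ltn_ord i) szB.
have x_inj i j : x i = x j -> i = j.
  move=> /eqP; rewrite nth_uniq ?fset_uniq//; first by move/eqP/val_inj.
  - exact: leq_trans (ltn_ord i) szB.
  - exact: leq_trans (ltn_ord j) szB.
pose w i := (wN (x i)).1.
pose C : 'M[K]_(k.+1, k) := \matrix_(i, j) mcoeff (tnth (in_tuple ms) j) (w i).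
have /rowV0Pn[l lker l0] : kermx C != 0.
  by rewrite -mxrank_eq0 mxrank_ker subn_eq0 -ltnNge ltnS rank_leq_col.
have lC : l *m C = 0 by apply/sub_kermxP.
have lw : \sum_i l 0 i *: w i = 0.
  apply/mpolyP => mo; rewrite mcoeff0 raddf_sum /=.
  have [mos|mos] := boolP (mo \in ms).
    have oi : (index mo ms < k)%N by rewrite index_mem.
    have := congr1 (fun M : 'rV[K]_k => M 0 (Ordinal oi)) lC.
    rewrite !mxE => {2}<-; apply: eq_bigr => i _.
    by rewrite mcoeffZ mxE (tnth_nth mo) /= nth_index.
  apply: big1 => i _; rewrite mcoeffZ memN_msupp_eq0 ?mulr0//.
  by have [-> _] := BsE _ (xB i).
(* This is the numerator of the sum of the fractions l_i / (X - x_i). At a root x_i only the i-th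
   term survives, so f is nonzero as soon as some l_i is. *)
pose f : {poly K} := \sum_i l 0 i *: \prod_(j | j != i) ('X - (x j)%:P).
have f0 : f != 0.
  have [i li] : exists i, l 0 i != 0.
    by have /rV0Pn := l0.
  apply: contra_neq li => f0.
  have := congr1 (horner^~ (x i)) f0.
  rewrite horner0 horner_sum (bigD1 i)//= [X in _ + X]big1 ?addr0 => [|j ji]; last first.
    rewrite hornerZ horner_prod (bigD1 i) 1?eq_sym//= hornerXsubC subrr.
    by rewrite mul0r mulr0.
  rewrite hornerZ horner_prod => /eqP; rewrite mulf_eq0 => /orP[/eqP//|].
  rewrite prodf_seq_eq0 => /hasP[j _ /andP[ji]].
  by rewrite !hornerE subr_eq0 => /eqP/x_inj ij; rewrite ij eqxx in ji.
have HE c : horner_alg theta ('X - c%:P) = theta - c%:A.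
  by rewrite rmorphB /= horner_algX horner_algC.
have HZ c (g : {poly K}) : horner_alg theta (c *: g) = c *: horner_alg theta g.
  by rewrite -mul_polyC rmorphM /= horner_algC mulr_algl.
have Pf : P (horner_alg theta f).
  suff : P (H ^+ N * horner_alg theta f).
    case/avoiding_ideal_prime => //.
    by move=> /PH.
  (* In the i-th term, H^N is congruent modulo [P] to (theta - x_i) w_i. After this replacement all
     terms share the full product over j, and the sum of the l_i w_i vanishes. *)
  have -> : H ^+ N * horner_alg theta f = \sum_i
     (- (l 0 i *: \prod_(j | j != i) (theta - (x j)%:A))) *
       ((theta - (x i)%:A) * w i - H ^+ N).
    transitivity (\sum_i (H ^+ N * (l 0 i *: \prod_(j | j != i) (theta - (x j)%:A))
       - (\prod_j (theta - (x j)%:A)) * (l 0 i *: w i))).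
      rewrite big_split /= sumrN -!mulr_sumr lw mulr0 subr0; congr (_ * _).
      rewrite rmorph_sum; apply: eq_bigr => i _.
      rewrite [LHS]HZ [in LHS]rmorph_prod; congr (_ *: _).
      by apply: eq_bigr => j _; exact: HE.
    apply: eq_bigr => i _; rewrite [X in _ - X * _](bigD1 i)//=.
    set p := \prod_(_ | _) _.
    by rewrite -!mul_mpolyC; ring.
  apply: ideal_sum => i; apply: PM.
  by have := wNP (x i); have [_ ->] := BsE _ (xB i).
(* As [P] is prime and f splits, [P] contains theta - r for a root r of f, against the assumption;
   the leading coefficient is a unit and cannot lie in [P]. *)
have [rs fE] := closed_field_poly_normal f.
move: Pf; rewrite fE HZ rmorph_prod -mul_mpolyC.
case/avoiding_ideal_prime.
  move=> /(@PM (mpolyC n (lead_coef f)^-1)).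
  rewrite -rmorphM /= mulVf ?lead_coef_eq0// => P1.
  by case: (PH (N := 0)).
have : P (\prod_(r <- rs) (theta - r%:A)) -> False.
  elim: rs {fE} => [|r rs IH]; first by rewrite big_nil => /(PH (N := 0)).
  rewrite big_cons => /avoiding_ideal_prime[Pr|//].
  by apply: nrho; exists r.
move=> nP Pp; apply: nP; move: Pp.
by rewrite (eq_bigr (fun r => theta - r%:A)) // => r _; exact: HE.
Qed.

(** The coordinates of [z] are the residues of the variables. Reduction modulo [P] and evaluation at
    [z] then agree on constants and variables, hence on all polynomials. *)
Lemma avoiding_ideal_point : exists z, forall p, P (p - (meval z p)%:A).
Proof.
have /choice[z zP] i : exists r, P (mpolyX K (mnm1 i) - r%:A) by exact: residue_scalar.
exists z.
have MC c : P (mpolyC n c - (meval z (mpolyC n c))%:A).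
  by rewrite mevalC -mul_mpolyC mulr1 subrr.
have MM p q : P (p - (meval z p)%:A) -> P (q - (meval z q)%:A) ->
    P (p * q - (meval z (p * q))%:A).
  move=> Pp Pq; rewrite mevalM.
  rewrite (_ : _ - _ = q * (p - (meval z p)%:A) + (meval z p)%:A * (q - (meval z q)%:A)).
    by apply: PD; exact: PM.
  by rewrite -!mul_mpolyC rmorphM /=; ring.
have MD p q : P (p - (meval z p)%:A) -> P (q - (meval z q)%:A) ->
    P (p + q - (meval z (p + q))%:A).
  move=> Pp Pq; rewrite mevalD scalerDl opprD addrACA; exact: PD.
elim/mpolyind => [|c m p _ _ IH]; first by rewrite raddf0 scale0r subr0.
apply: MD => //; rewrite -mul_mpolyC mpolyXE_id; apply: (MM) => //.
apply: (big_ind (fun p => P (p - (meval z p)%:A))) => [|p1 p2|i _].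
- exact: (MC 1).
- exact: MM.
- elim: (m i) => [|k IHk]; first by rewrite expr0; exact: (MC 1).
  rewrite exprS; apply: (MM) => //.
  by rewrite mevalXU.
Qed.
End Prime.

(** A nonzero constant in [P] would put H^0 = 1 into [P], so membership in [P] forces the value at
    the point to be 0. Taking [H] = 1 gives the weak form. *)
Theorem nullstellensatz (J : set A) (H : A) :
  is_ideal J -> (forall N, ~ J (H ^+ N)) ->
  exists z, (forall p, J p -> meval z p = 0) /\ meval z H != 0.
Proof.
move=> idJ /(maximal_avoiding_ideal idJ)[P [idP JP PH Pmax]].
have [z zP] := avoiding_ideal_point idP PH Pmax; have [_ PD PM] := idP.
have nPc c : P c%:A -> c = 0.
  move=> Pc; apply: contrapT => /eqP c0; apply: (PH 0).
  rewrite (_ : H ^+ 0 = c^-1%:A * c%:A); first exact: PM.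
  by rewrite mulr_algl scalerA mulVf// scale1r.
have zE p : P p -> meval z p = 0.
  move=> Pp; apply: nPc.
  rewrite (_ : _%:A = p + (-1) * (p - (meval z p)%:A)); last by ring.
  by apply: PD => //; exact: PM.
exists z; split=> [p /JP /zE //|].
apply/eqP => H0; apply: (PH 1); rewrite expr1.
by have := zP H; rewrite H0 scale0r subr0.
Qed.
End Nullstellensatz.

(** * Sections and generators *)

Section Evaluation.
Variables (K : fieldType) (X : fspace K).
Implicit Types U V W : opens X.

(* junk value 0 outside U *)
Definition ev U (f : oring U) (x : X) : K :=
  if pselect (U x) is left Ux then f (SigSub (mem_set Ux)) else 0.

Lemma evE U (f : oring U) (x : set_type U) : ev f (val x) = f x.
Proof.
rewrite /ev; case: pselect => [Ux|nUx]; last by case: nUx; exact: set_valP.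
by congr (ofun f _); exact/val_inj.
Qed.

Lemma evE_in U (f : oring U) x (Ux : x \in (U : set X)) :
  ev f x = f (SigSub Ux).
Proof. by rewrite -evE. Qed.

Lemma oringP U (f g : oring U) : (forall x, U x -> ev f x = ev g x) -> f = g.
Proof.
move=> fg; apply: oring_ext => x; rewrite -!evE; apply: fg; exact: set_valP.
Qed.

Lemma ev_reg U (f : oring U) : reg_on U (ev f).
Proof.
have /asboolP[g rg eg] := ofunP f; move=> x Ux.
apply: reg_near (rg x Ux); near=> y.
have Uy : U y.
  by near: y; exact: open_nbhs_nbhs (conj (oset_open U) Ux).
by rewrite (evE_in _ (mem_set Uy)) eg.
Unshelve. all: by end_near. Qed.

Lemma mkO_subproof U (g : X -> K) : reg_on U g ->
  (fun x : set_type U => g (val x)) \in @regular_pred _ _ U.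
Proof. by move=> rg; apply/asboolP; exists g. Qed.

Definition mkO U (g : X -> K) (rg : reg_on U g) : oring U :=
  ORing (mkO_subproof rg).

Lemma ev_mkO U g (rg : reg_on U g) x : U x -> ev (mkO rg) x = g x.
Proof. by move=> Ux; rewrite (evE_in _ (mem_set Ux)). Qed.

Lemma evD U (f g : oring U) x : ev (f + g) x = ev f x + ev g x.
Proof. by rewrite /ev; case: pselect => // _; rewrite addr0. Qed.

Lemma evM U (f g : oring U) x : ev (f * g) x = ev f x * ev g x.
Proof. by rewrite /ev; case: pselect => // _; rewrite mulr0. Qed.

Lemma evN U (f : oring U) x : ev (- f) x = - ev f x.
Proof. by rewrite /ev; case: pselect => // _; rewrite oppr0. Qed.

Lemma ev0 U x : ev (0 : oring U) x = 0.
Proof. by rewrite /ev; case: pselect. Qed.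

Lemma ev1 U x : U x -> ev (1 : oring U) x = 1.
Proof. by move=> Ux; rewrite (evE_in _ (mem_set Ux)). Qed.

Lemma ev_res U V (h : V `<=` U) (f : oring U) x : V x -> ev (ores h f) x = ev f x.
Proof.
move=> Vx; rewrite (evE_in _ (mem_set Vx)) (evE_in _ (mem_set (h _ Vx))) /=.
by congr (ofun f _); exact/val_inj.
Qed.

Lemma oresD U V (h : V `<=` U) (f g : oring U) : ores h (f + g) = ores h f + ores h g.
Proof. exact: oring_ext. Qed.
Lemma oresN U V (h : V `<=` U) (f : oring U) : ores h (- f) = - ores h f.
Proof. exact: oring_ext. Qed.
Lemma oresM U V (h : V `<=` U) (f g : oring U) : ores h (f * g) = ores h f * ores h g.
Proof. exact: oring_ext. Qed.
Lemma ores1 U V (h : V `<=` U) : ores h (1 : oring U) = 1.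
Proof. exact: oring_ext. Qed.
Lemma ores0 U V (h : V `<=` U) : ores h (0 : oring U) = 0.
Proof. exact: oring_ext. Qed.
Lemma ores_id U (h : U `<=` U) (f : oring U) : ores h f = f.
Proof. by apply: oringP => x Ux; rewrite ev_res. Qed.
Lemma ores_comp U V W (h : V `<=` U) (h' : W `<=` V) (h'' : W `<=` U) (f : oring U) :
  ores h' (ores h f) = ores h'' f.
Proof. by apply: oringP => x Wx; rewrite !ev_res//; exact: h'. Qed.

Lemma ounit_nonzero U (f : oring U) : (forall x, U x -> ev f x != 0) -> is_ounit f.
Proof.
move=> f0; have rg : reg_on U (fun x => (ev f x)^-1).
  by move=> x Ux; have [] := reg_inv (ev_reg f Ux) (f0 _ Ux).
exists (mkO rg); apply: oringP => x Ux.
by rewrite evM ev_mkO// ev1// mulfV// f0.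
Qed.

Lemma ounit_res U V (h : V `<=` U) (f : oring U) : is_ounit f -> is_ounit (ores h f).
Proof. by move=> [g fg]; exists (ores h g); rewrite -oresM fg ores1. Qed.

Lemma ounitM U (f g : oring U) : is_ounit f -> is_ounit g -> is_ounit (f * g).
Proof.
by move=> [f' ff'] [g' gg']; exists (f' * g'); rewrite mulrACA ff' gg' mulr1.
Qed.

Lemma ounit_oinv U (f : oring U) : is_ounit f -> f * Defs.oinv f = 1.
Proof. by move=> [g fg]; rewrite /Defs.oinv; case: xgetP => [_ _ //|/(_ g)]. Qed.

End Evaluation.

Section Irreducible.
Variables (K : fieldType) (X : fspace K).
Implicit Types U V W : opens X.

Lemma openD (f : X -> K) U : reg_on U f -> open [set x | U x /\ f x != 0].
Proof.
move=> rf; rewrite openE => x [Ux fx].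
have [f0 _] := reg_inv (rf _ Ux) fx.
apply: filterS2 (open_nbhs_nbhs (conj (oset_open U) Ux)) f0.
by move=> y Uy fy; split.
Qed.

Hypothesis irrX : irreducible_set [set: X].

Lemma open_meet U V : U !=set0 -> V !=set0 -> (U `&` V) !=set0.
Proof.
move=> [x Ux] [y Vy]; apply: contrapT => UV0.
have [|sub|sub] := irrX.2 _ _ (open_closedC (oset_open U)) (open_closedC (oset_open V)).
- move=> z _; have [Uz|nUz] := pselect (U z); last by left.
  by right => Vz; apply: UV0; exists z.
- exact: (sub x I).
- exact: (sub y I).
Qed.

(** The open set where [f] does not vanish would have to meet [V], by irreducibility, if it were
    nonempty. *)
Lemma eq0_dense U V (f : oring U) : V !=set0 ->
  (forall x, U x -> V x -> ev f x = 0) -> f = 0.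
Proof.
move=> V0 f0; apply: oringP => x Ux; rewrite ev0; apply: contrapT => /eqP fx.
have Do := openD (ev_reg f).
have [|y [[Uy fy] Vy]] := @open_meet (Opens Do) V _ V0; first by exists x.
by rewrite f0// eqxx in fy.
Qed.

End Irreducible.

Section Generators.
Variables (K : fieldType) (X : fspace K).
Implicit Types (A : omod X) (U V W : opens X).

Lemma res_irr A U V (h h' : V `<=` U) (s : sec A U) : res h s = res h' s.
Proof. by congr (res _ s); exact: Prop_irrelevance. Qed.

Lemma sec_empty A U (s s' : sec A U) : (forall x, ~ U x) -> s = s'.
Proof.
move=> U0; apply: (@sec_sep _ _ A U False (fun i => match i with end)
  (fun i : False => match i with end)) => [x /U0 //|[]].
Qed.

Lemma res0 A U V (h : V `<=` U) : res h (0 : sec A U) = 0.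
Proof. by have := resZ h 0 (0 : sec A U); rewrite ores0 !scale0r. Qed.

Lemma resN A U V (h : V `<=` U) (s : sec A U) : res h (- s) = - res h s.
Proof. by rewrite -scaleN1r resZ oresN ores1 scaleN1r. Qed.

Lemma sec_locP A U (s s' : sec A U) :
  (forall x, U x -> exists W (h : W `<=` U), W x /\ res h s = res h s') -> s = s'.
Proof.
move=> loc.
pose I := {W : opens X | exists h : W `<=` U, res h s = res h s'}.
have hI (i : I) : sval i `<=` U by case: (svalP i).
apply: (sec_sep (V := fun i : I => sval i) (h := hI)).
  move=> x /loc[W [h [Wx e]]]; unshelve eexists; first by exists W; exists h.
  exact: Wx.
move=> i; case: (svalP i) => h e.
by rewrite (res_irr _ h) e; exact: res_irr.
Qed.

Lemma gen_res A U V (h : V `<=` U) (e : sec A U) : is_gen e -> is_gen (res h e).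
Proof.
move=> ge W hW s; have hWU : W `<=` U by move=> x /hW /h.
by have := ge W hWU s; rewrite (res_comp h hW hWU).
Qed.

Lemma gen_uniq A U (e : sec A U) : is_gen e ->
  forall V (h : V `<=` U) (c d : oring V), c *: res h e = d *: res h e -> c = d.
Proof.
move=> ge V h c d ecd; have [b [_ ub]] := ge V h (c *: res h e).
by rewrite -(ub c)// -(ub d).
Qed.

Lemma gen_eq0 A U (e : sec A U) : is_gen e ->
  forall V (h : V `<=` U) (c : oring V), c *: res h e = 0 -> c = 0.
Proof. by move=> ge V h c; rewrite -(scale0r (res h e)) => /(gen_uniq ge). Qed.

Lemma gen_ex A U (e : sec A U) : is_gen e ->
  forall V (h : V `<=` U) (s : sec A V), exists c, s = c *: res h e.
Proof. by move=> ge V h s; have [c [-> _]] := ge V h s; exists c. Qed.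

Lemma is_genP A U (e : sec A U) :
  (forall V (h : V `<=` U) (s : sec A V), exists c, s = c *: res h e) ->
  (forall V (h : V `<=` U) (c : oring V), c *: res h e = 0 -> c = 0) -> is_gen e.
Proof.
move=> ex un V h s; have [c sE] := ex V h s; exists c; split=> // d dE.
apply/eqP; rewrite -subr_eq0; apply/eqP; apply: (un V h).
by rewrite scalerBl -dE -sE subrr.
Qed.

Lemma gen_scale A U (e : sec A U) (c : oring U) :
  is_ounit c -> is_gen e -> is_gen (c *: e).
Proof.
move=> [d cd] ge; have cdV V (h : V `<=` U) : ores h c * ores h d = 1.
  by rewrite -oresM cd ores1.
apply: is_genP => V h s.
  have [b ->] := gen_ex ge h s; exists (b * ores h d).
  by rewrite resZ scalerA -mulrA (mulrC (ores h d)) cdV mulr1.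
rewrite resZ scalerA => /(gen_eq0 ge) sc0.
by rewrite -[s]mulr1 -(cdV _ h) mulrA sc0 mul0r.
Qed.

(** This stands for the nonvanishing of [e] in the fibre of a line bundle at [x], without stalks or
    fibres. *)
Definition gen_at A U (e : sec A U) (x : X) :=
  exists W (h : W `<=` U), W x /\ is_gen (res h e).

(** Coefficients with respect to [e] are unique wherever they exist, so the local ones agree on
    overlaps and glue as sections of [O_mod]. *)
Lemma gen_local A U (e : sec A U) : (forall x, U x -> gen_at e x) -> is_gen e.
Proof.
move=> loc.
have un V (h : V `<=` U) (c : oring V) : c *: res h e = 0 -> c = 0.
  move=> ce0; apply: oringP => x Vx; rewrite ev0.
  have [W [hW [Wx ge]]] := loc _ (h _ Vx).
  pose V' := opensI V W.
  have h1 : V' `<=` V by move=> ? [].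
  have h2 : V' `<=` W by move=> ? [].
  have h3 : V' `<=` U by move=> y [_ /hW].
  have := congr1 (res h1) ce0; rewrite resZ res0.
  rewrite (res_comp _ _ h3) -(res_comp hW h2) => /(gen_eq0 ge) c0.
  by rewrite -(@ev_res _ _ _ _ h1)// c0 ev0.
apply: is_genP => // V h s.
pose I := {W : opens X | exists h' : W `<=` V, exists c : oring W,
   res h' s = c *: res (fun x Wx => h _ (h' _ Wx)) e}.
have hI (i : I) : sval i `<=` V by case: (svalP i).
have cex (i : I) : exists c : oring (sval i),
   res (hI i) s = c *: res (fun x Wx => h _ (hI i _ Wx)) e.
  case: (svalP i) => h' [c cE]; exists c.
  by rewrite (res_irr _ h') cE; congr (_ *: _); exact: res_irr.
pose c i := projT1 (cid (cex i)); have cP i := projT2 (cid (cex i)).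
rewrite -/(c _) in cP.
have [||b bE] := @sec_glue _ _ (O_mod X) V I (fun i => sval i) hI _ (c : forall i, sec (O_mod X) (sval i)).
- move=> x Vx; have [W [hW [Wx ge]]] := loc _ (h _ Vx).
  pose V' := opensI V W.
  have h1 : V' `<=` V by move=> ? [].
  have h2 : V' `<=` W by move=> ? [].
  have [c0 c0E] := gen_ex ge h2 (res h1 s).
  unshelve eexists.
    exists V'; exists h1, c0; rewrite c0E; congr (_ *: _).
    exact: res_comp.
  by [].
- move=> i j W hi hj.
  have hWU : W `<=` U by move=> x /hi /hI /h.
  apply/eqP; rewrite -subr_eq0; apply/eqP; apply: (un W hWU).
  have hWV : W `<=` V by move=> x /hi /hI.
  have := congr1 (res hi) (cP i); have := congr1 (res hj) (cP j).
  rewrite !resZ !(res_comp _ _ hWV) !(res_comp _ _ hWU) => e1 e2.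
  by rewrite scalerBl /= -e1 -e2 subrr.
exists b; apply: (sec_sep (h := hI)) => [x Vx|i].
  have [W [hW [Wx ge]]] := loc _ (h _ Vx).
  pose V' := opensI V W.
  have h1 : V' `<=` V by move=> ? [].
  have h2 : V' `<=` W by move=> ? [].
  have [c0 c0E] := gen_ex ge h2 (res h1 s).
  unshelve eexists.
    exists V'; exists h1, c0; rewrite c0E; congr (_ *: _).
    exact: res_comp.
  by [].
rewrite cP resZ; have /= -> := bE i; congr (_ *: _).
by rewrite (res_comp _ _ (fun x Wx => h _ (hI i _ Wx))).
Qed.

(** Near [x] the section [s] is a multiple d t of the generator t, so t = c d t and c d = 1; hence
    [s] differs from a generator by a unit. *)
Lemma gen_at_factor A U V (s : sec A U) (t : sec A V) x W
    (hU : W `<=` U) (hV : W `<=` V) (c : oring W) :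
  W x -> res hV t = c *: res hU s -> gen_at t x -> gen_at s x.
Proof.
move=> Wx tE [W' [h' [W'x gt]]]; pose V' := opensI W W'.
have h1 : V' `<=` W by move=> ? [].
have h2 : V' `<=` W' by move=> ? [].
have h3 : V' `<=` U by move=> y /h1 /hU.
have h4 : V' `<=` V by move=> y /h1 /hV.
exists V', h3; split=> //.
have [d sE] := gen_ex gt h2 (res h3 s).
have gt' : is_gen (res h4 t) by rewrite -(res_comp h' h2 h4); exact: gen_res.
rewrite (res_comp _ _ h4) in sE.
rewrite sE; apply: gen_scale => //; exists (ores h1 c).
have hid : V' `<=` V' by [].
apply: (gen_uniq gt' (h := hid)); rewrite res_id scale1r mulrC -scalerA -sE.
have := congr1 (res h1) tE; rewrite resZ (res_comp _ _ h4) => ->.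
by rewrite (res_comp _ _ h3).
Qed.

Lemma triv1_gen A U : triv A U 1 -> exists e : sec A U, is_gen e.
Proof.
move=> t; have hid : U `<=` U by [].
have [f tf ft] := triv_bij t hid.
exists (f 1%:M); set e := f _.
have tE V (h : V `<=` U) (c : oring V) : t V h (c *: res h e) = c%:M.
  have := triv_linear t h c (res h e) 0; rewrite !addr0 => ->.
  have -> : t V h 0 = 0.
    have := triv_linear t h 1 0 0; rewrite !scale1r addr0.
    by move/(congr1 (fun x => x - t V h 0)); rewrite addrK subrr.
  rewrite addr0; apply/matrixP => i j.
  by rewrite !ord1 mxE (triv_res t hid h h) ft !mxE eqxx !mulr1n ores1 mulr1.
apply: is_genP => V h s; have [g tg gt] := triv_bij t h.
  exists (t V h s 0 0); apply: (can_inj tg); rewrite tE.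
  by apply/matrixP => i j; rewrite !ord1 mxE eqxx.
move=> se0; have := tE V h s; rewrite se0.
have -> : t V h 0 = 0.
  have := triv_linear t h 1 0 0; rewrite !scale1r addr0.
  by move/(congr1 (fun x => x - t V h 0)); rewrite addrK subrr.
by move/matrixP/(_ 0 0); rewrite !mxE.
Qed.

Lemma line_bundle_gen A x : line_bundle A ->
  exists U (e : sec A U), U x /\ is_gen e.
Proof.
move=> /(_ x)[U [Ux [t]]]; have [e ge] := triv1_gen t; by exists U, e.
Qed.

End Generators.

(** * Line bundles on affine open sets *)

Section LineBundlesOnAffine.
Variables (K : closedFieldType) (X : fspace K).
Hypothesis uncountableK : ~ countable [set: K].
Hypothesis irrX : irreducible_set [set: X].
Implicit Types (U V W : opens X).
Variable A : omod X.
Hypothesis lineA : line_bundle A.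

(** The coefficient of [s - s'] with respect to a local generator vanishes on a dense open set,
    hence identically. *)
Lemma sec_eq_dense U V (h : V `<=` U) (s s' : sec A U) : V !=set0 ->
  res h s = res h s' -> s = s'.
Proof.
move=> V0 e; apply: sec_locP => x Ux.
have [W [g [Wx gg]]] := line_bundle_gen x lineA.
pose W' := opensI U W.
have h1 : W' `<=` U by move=> ? [].
have h2 : W' `<=` W by move=> ? [].
exists W', h1; split => //.
have [c cE] := gen_ex gg h2 (res h1 (s - s')).
suff c0 : c = 0.
  by apply/eqP; rewrite -subr_eq0 -resN -resD cE c0 scale0r.
apply: (eq0_dense irrX (V := V) V0) => y W'y Vy.
pose V' := opensI W' V.
have k1 : V' `<=` W' by move=> ? [].
have k2 : V' `<=` V by move=> ? [].
have k3 : V' `<=` U by move=> z /k1 /h1.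
rewrite -(@ev_res _ _ _ _ k1)//.
suff -> : ores k1 c = 0 by rewrite ev0.
apply: (gen_eq0 gg (h := fun z V'z => h2 _ (k1 _ V'z))).
rewrite -(res_comp h2 k1) -resZ -cE (res_comp _ _ k3) -(res_comp h k2).
by rewrite resD resN e subrr res0.
Qed.

Variables (Z : opens X) (n : nat) (z : X -> 'I_n -> K) (S : set (mpoly n K)).
Hypothesis zbij : set_bij Z (zero_locus S) z.
Hypothesis zopen : forall B : set X, B `<=` Z ->
  (open B <-> exists S' : set (mpoly n K),
     forall x, Z x -> (B x <-> ~ zero_locus S' (z x))).
Hypothesis zreg : forall x (f : X -> K), Z x ->
  (reg_at x f <-> exists p q : mpoly n K,
    meval (z x) q != 0 /\ \forall y \near x, f y = meval (z y) p / meval (z y) q).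

Lemma princ_open (u : mpoly n K) : open [set x | Z x /\ meval (z x) u != 0].
Proof.
apply/zopen; first by move=> x [].
exists [set u] => x Zx; split=> [[_ ux] /(_ u erefl)|nu].
  by move/eqP; rewrite (negbTE ux).
by split=> //; apply/eqP => ux; apply: nu => p ->.
Qed.

Definition princ u : opens X := Opens (princ_open u).

Lemma princ_basis W x : Z x -> W x ->
  exists u, meval (z x) u != 0 /\ princ u `<=` W.
Proof.
move=> Zx Wx.
have [S' S'P] := (zopen (B := W `&` Z) (@subIsetr _ _ _)).1
  (openI (oset_open W) (oset_open Z)).
have : ~ zero_locus S' (z x) by apply/S'P.
move=> /existsNP[u /not_implyP[S'u /eqP ux]]; exists u; split=> //.
move=> y [Zy uy]; suff : (W `&` Z) y by case.
by apply/S'P => // /(_ u S'u)/eqP; rewrite (negbTE uy).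
Qed.

Lemma reg_poly u x : Z x -> reg_at x (fun y => meval (z y) u).
Proof.
move=> Zx; apply/(zreg _ Zx); exists u, 1; rewrite meval1 oner_neq0; split=> //.
by apply: nearW => y; rewrite meval1 divr1.
Qed.

Definition opoly W (h : W `<=` Z) u : oring W :=
  mkO (fun x Wx => reg_poly u (h x Wx)).

Lemma ev_opoly W (h : W `<=` Z) u x : W x -> ev (opoly h u) x = meval (z x) u.
Proof. exact: ev_mkO. Qed.

Lemma ores_opoly W V (h : W `<=` Z) (k : V `<=` W) (h' : V `<=` Z) u :
  ores k (opoly h u) = opoly h' u.
Proof.
apply: oringP => x Vx; rewrite ev_res// !ev_opoly//; exact: k.
Qed.

Lemma opolyM W (h : W `<=` Z) u v : opoly h (u * v) = opoly h u * opoly h v.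
Proof. by apply: oringP => x Wx; rewrite evM !ev_opoly// mevalM. Qed.

(* The denominators of r form an ideal all of whose zeros lie outside D(v). *)
Lemma princ_section (v : mpoly n K) (r : oring (princ v)) :
  exists N p, forall x, princ v x ->
    meval (z x) v ^+ N * ev r x = meval (z x) p.
Proof.
pose J : set (mpoly n K) := [set u | exists p, forall x, princ v x ->
  meval (z x) u * ev r x = meval (z x) p].
suff [N [p JN]] : exists N, J (v ^+ N).
  by exists N, p => x vx; rewrite -JN// -rmorphXn.
apply: contrapT => nJ.
have idJ : is_ideal J.
  split.
  - by exists 0 => x _; rewrite raddf0 mul0r.
  - move=> u u' [p pE] [p' pE']; exists (p + p') => x vx.
    by rewrite !mevalD mulrDl pE// pE'.
  - move=> a u [p pE]; exists (a * p) => x vx.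
    by rewrite !mevalM -mulrA pE.
have [N JN|w [wJ vw]] := nullstellensatz uncountableK (H := v) idJ _.
  by apply: nJ; exists N.
(* The equations of [Z] vanish on D(v), so they belong to [J] with numerator 0; this places the
   point [w] on the image of [Z]. *)
have Sw : zero_locus S w.
  move=> p Sp; apply: wJ; exists 0 => x [Zx _].
  have /= Szx : zero_locus S (z x) by case: zbij => + _ _; exact.
  by rewrite raddf0 Szx// mul0r.
have [x Zx zx] : exists2 x, Z x & z x = w.
  by case: zbij => _ _ /(_ w Sw)[x]; exists x.
rewrite -zx in vw wJ.
have vx : princ v x by [].
have := ev_reg r vx.
case/(zreg _ Zx) => p [q [qx rpq]].
suff : J q by move=> /wJ /eqP; rewrite (negbTE qx).
exists p; have hv : princ v `<=` Z by move=> ? [].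
have [q0 _] := reg_inv (reg_poly q Zx) qx.
have [B [[oB Bx] BP]] : exists B : set X, open_nbhs x B /\ forall y, B y ->
    ev r y = meval (z y) p / meval (z y) q /\ meval (z y) q != 0.
  have : nbhs x [set y | ev r y = meval (z y) p / meval (z y) q /\ meval (z y) q != 0].
    by apply: filterS2 rpq q0.
  rewrite nbhsE => -[B oB sB].
  by exists B; split=> // y /sB.
(* The identity q r = p near [x] extends to all of D(v) by irreducibility, so the local denominator
   [q] lies in [J] although it does not vanish at [x]. *)
have /(congr1 (fun f : oring _ => f)) E : opoly hv q * r - opoly hv p = 0.
  apply: (eq0_dense irrX (V := Opens oB)); first by exists x.
  move=> y vy /BP[rE qy]; rewrite evD evN evM !ev_opoly// rE.
  by rewrite mulrCA divff// mulr1 subrr.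
move=> y vy; have := congr1 (fun f => ev f y) E.
by rewrite evD evN evM !ev_opoly// ev0 => /eqP; rewrite subr_eq0 => /eqP.
Qed.

(* The sections g over D(h) extend to Z after multiplication by a power of h:
   the u such that this holds over D(u) form an ideal without zeros on Z. *)
Lemma extend_section (h : mpoly n K) (O : opens X) (g : sec A O) (hO : princ h `<=` O) :
  is_gen g -> princ h !=set0 ->
  exists N (s : sec A Z), forall (kZ : princ h `<=` Z),
    res kZ s = opoly kZ (h ^+ N) *: res hO g.
Proof.
move=> gg h0.
pose J : set (mpoly n K) := [set u | exists N (s : sec A (princ u)),
  forall W (k1 : W `<=` princ u) (k2 : W `<=` O) (kZ : W `<=` Z), W `<=` princ h ->
    res k1 s = opoly kZ (h ^+ N) *: res k2 g].
(* Besides the zero polynomial, this puts the equations of [Z] into [J]. *)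
have J_empty u : (forall x, ~ princ u x) -> J u.
  move=> u0; exists 0%N, 0 => W k1 k2 kZ _; apply: sec_empty => x /k1; exact: u0.
have idJ : is_ideal J.
  split.
  - by apply: J_empty => x [_]; rewrite raddf0 eqxx.
  - move=> u u' [N [s sP]] [N' [s' sP']].
    pose I := bool; pose V (i : I) := opensI (princ (u + u')) (if i then princ u else princ u').
    have hV i : V i `<=` princ (u + u') by move=> ? [].
    have hZ : princ (u + u') `<=` Z by move=> ? [].
    have hZV i : V i `<=` Z by move=> ? /hV /hZ.
    have V1 : V true `<=` princ u by move=> ? [].
    have V2 : V false `<=` princ u' by move=> ? [].
    (* Cross multiplication by powers of [h] gives both pieces the same exponent N + N'. *)
    pose t (i : I) : sec A (V i) := if i as b return sec A (V b) then
      opoly (hZV true) (h ^+ N') *: res V1 s else opoly (hZV false) (h ^+ N) *: res V2 s'.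
    have tP i W (k1 : W `<=` V i) (k2 : W `<=` O) (kZ : W `<=` Z) : W `<=` princ h ->
      res k1 (t i) = opoly kZ (h ^+ (N + N')) *: res k2 g.
      move=> Wh; rewrite exprD opolyM; case: i k1 => k1 /=.
        have k3 : W `<=` princ u by move=> ? /k1 /V1.
        by rewrite resZ (res_comp _ _ k3) (sP _ _ k2 kZ)// scalerA (ores_opoly _ _ kZ) mulrC.
      have k3 : W `<=` princ u' by move=> ? /k1 /V2.
      by rewrite resZ (res_comp _ _ k3) (sP' _ _ k2 kZ)// scalerA (ores_opoly _ _ kZ).
    have [||se seP] := @sec_glue _ _ A _ I V hV _ t.
    + move=> x [Zx ux]; have [u0|un0] := eqVneq (meval (z x) u) 0; last first.
        by exists true; split=> //; split.
      exists false; split => //; split=> //; apply: contra ux => /eqP u'0.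
      by rewrite mevalD u0 u'0 addr0.
    + move=> i j W hi hj.
      have [W0|W0] := pselect (W !=set0); last first.
        by apply: sec_empty => x Wx; apply: W0; exists x.
      have hWh : opensI W (princ h) `<=` W by move=> ? [].
      have hWh2 : opensI W (princ h) `<=` princ h by move=> ? [].
      (* The two pieces are compared with [g] only inside D(h), which is dense as [X] is
         irreducible. *)
      apply: (sec_eq_dense (h := hWh)); first exact: (open_meet irrX W0 h0).
      have ki : opensI W (princ h) `<=` V i by move=> ? /hWh /hi.
      have kj : opensI W (princ h) `<=` V j by move=> ? /hWh /hj.
      have kO : opensI W (princ h) `<=` O by move=> ? /hWh2 /hO.
      have kZ : opensI W (princ h) `<=` Z by move=> ? [_ []].
      by rewrite (res_comp _ _ ki) (res_comp _ _ kj) !(tP _ _ _ kO kZ).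
    exists (N + N')%N, se => W k1 k2 kZ Wh.
    pose W' i := opensI W (V i).
    have hW' i : W' i `<=` W by move=> ? [].
    apply: (sec_sep (h := hW')).
      move=> x Wx; have [Zx ux] := k1 _ Wx.
      have [u0|un0] := eqVneq (meval (z x) u) 0; last first.
        by exists true; split=> //; split=> //; split.
      exists false; split => //; split=> //; split=> //; apply: contra ux => /eqP u'0.
      by rewrite mevalD u0 u'0 addr0.
    move=> i; have l1 : W' i `<=` V i by move=> ? [].
    have l2 : W' i `<=` princ (u + u') by move=> ? /l1 /hV.
    have l3 : W' i `<=` O by move=> ? /hW' /k2.
    have l4 : W' i `<=` Z by move=> ? /hW' /kZ.
    have l5 : W' i `<=` princ h by move=> ? /hW' /Wh.
    rewrite (res_comp _ _ l2) -(res_comp (hV i) l1) seP (tP _ _ _ l3 l4)//.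
    by rewrite resZ (ores_opoly _ _ l4) (res_comp _ _ l3).
  - move=> a u [N [s sP]].
    have k : princ (a * u) `<=` princ u.
      by move=> x [Zx]; rewrite mevalM mulf_eq0 => /norP[].
    exists N, (res k s) => W k1 k2 kZ Wh.
    have k3 : W `<=` princ u by move=> ? /k1 /k.
    by rewrite (res_comp _ _ k3); exact: sP.
have [[N JN]|nJ] := pselect (exists N, J (1 ^+ N)).
  have {JN} [M [s sP]] : J 1 by move: JN; rewrite expr1n.
  have Z1 : Z `<=` princ 1 by move=> x Zx; split=> //; rewrite meval1 oner_neq0.
  exists M, (res Z1 s) => kZ.
  have k1 : princ h `<=` princ 1 by move=> x /kZ /Z1.
  by rewrite (res_comp _ _ k1); exact: sP.
have [N JN|w [wJ _]] := nullstellensatz uncountableK (H := 1) idJ.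
  by apply: nJ; exists N.
have Sw : zero_locus S w.
  move=> p Sp; apply: wJ; apply: J_empty => x [Zx]; apply/negP; rewrite negbK.
  have /= Szx : zero_locus S (z x) by case: zbij => + _ _; exact.
  by rewrite Szx.
have [x Zx zx] : exists2 x, Z x & z x = w.
  by case: zbij => _ _ /(_ w Sw)[x]; exists x.
have {}wJ u : J u -> meval (z x) u = 0 by rewrite zx; exact: wJ.
have [O' [g' [O'x gg']]] := line_bundle_gen x lineA.
have [h' [h'x h'O]] := princ_basis Zx O'x.
suff /wJ/eqP : J h' by rewrite (negbTE h'x).
have q1 : princ (h * h') `<=` princ h.
  by move=> y [Zy]; rewrite mevalM mulf_eq0 => /norP[].
have q2 : princ (h * h') `<=` princ h'.
  by move=> y [Zy]; rewrite mevalM mulf_eq0 => /norP[].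
have q3 : princ (h * h') `<=` O by move=> y /q1 /hO.
have q4 : princ (h * h') `<=` O' by move=> y /q2 /h'O.
have [r rE] := gen_ex gg' q4 (res q3 g).
(* On D(h h') one has g = r g' and (h h')^N r = p, so h^N g = (p / h'^N) g'. The right-hand side is
   defined on all of D(h'), which puts h' into [J] although h' does not vanish at [x]. *)
have [N [p pE]] := princ_section r.
have h'Z : princ h' `<=` Z by move=> ? [].
have [b bP] : is_ounit (opoly h'Z (h' ^+ N)).
  apply: ounit_nonzero => y h'y; rewrite ev_opoly// rmorphXn expf_neq0//.
  by case: h'y.
exists N, ((opoly h'Z p * b) *: res h'O g') => W k1 k2 kZ Wh.
have l : W `<=` princ (h * h').
  move=> y Wy; split; first exact: kZ.
  by rewrite mevalM mulf_neq0//; [case: (Wh _ Wy)|case: (k1 _ Wy)].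
have kO' : W `<=` O' by move=> ? /l /q4.
rewrite resZ (res_comp _ _ kO') -(res_comp q3 l) rE resZ scalerA (res_comp _ _ kO').
congr (_ *: _); apply: oringP => y Wy.
have hy' : meval (z y) h' ^+ N != 0 by rewrite expf_neq0//; case: (k1 _ Wy).
have := congr1 (fun f => ev f y) bP.
rewrite evM ev1 ?ev_opoly; [|exact: k1|exact: k1] => bE.
rewrite ev_res// evM ev_opoly; last exact: k1.
rewrite evM ev_opoly// ev_res//; apply: (mulfI hy').
rewrite -rmorphXn /= mulrCA bE mulr1 -pE; last exact: l.
by rewrite mevalM exprMn !rmorphXn /=; ring.
Qed.

(** Multiplying a local generator by a power of [h] allows it to extend to [Z], and [h] is a unit on
    D(h), so the extension still generates there. *)
Lemma affine_line_bundle_gen x : Z x -> exists s : sec A Z, gen_at s x.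
Proof.
move=> Zx; have [O [g [Ox gg]]] := line_bundle_gen x lineA.
have [h [hx hO]] := princ_basis Zx Ox.
have h0 : princ h !=set0 by exists x.
have [N [s sP]] := extend_section hO gg h0.
have kZ : princ h `<=` Z by move=> ? [].
exists s, (princ h), kZ; split=> //; rewrite sP; apply: gen_scale; last exact: gen_res.
apply: ounit_nonzero => y hy; rewrite ev_opoly// rmorphXn expf_neq0//.
by case: hy.
Qed.

End LineBundlesOnAffine.

Theorem line_bundle_globally_generated (K : closedFieldType) (X : fspace K)
    (A : omod X) (Z : opens X) (x : X) :
  ~ countable [set: K] -> irreducible_set [set: X] -> line_bundle A ->
  is_affine Z -> Z x -> exists s : sec A Z, gen_at s x.
Proof.
move=> uK irrX lineA [_ [n [z [S [zbij zopen zreg]]]]].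
by apply: (affine_line_bundle_gen uK irrX lineA zbij zopen).
Qed.

(** * Tensor products with a line bundle *)

Section Obilin.
Variables (K : fieldType) (X : fspace K) (A B C : omod X) (b : obilin A B C).
Variables (U : opens X).

Lemma obilDl (s s' : sec A U) t : b U (s + s') t = b U s t + b U s' t.
Proof. by have := obil_linearl b t 1 s s'; rewrite !scale1r. Qed.
Lemma obilDr (s : sec A U) t t' : b U s (t + t') = b U s t + b U s t'.
Proof. by have := obil_linearr b s 1 t t'; rewrite !scale1r. Qed.
Lemma obil0l t : b U (0 : sec A U) t = 0.
Proof. by apply: (addIr (b U (0 : sec A U) t)); rewrite -obilDl !add0r. Qed.
Lemma obil0r (s : sec A U) : b U s 0 = 0.
Proof. by apply: (addIr (b U s 0)); rewrite -obilDr !add0r. Qed.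
Lemma obilZl a (s : sec A U) t : b U (a *: s) t = a *: b U s t.
Proof. by have := obil_linearl b t a s 0; rewrite obil0l !addr0. Qed.
Lemma obilZr a (s : sec A U) t : b U s (a *: t) = a *: b U s t.
Proof. by have := obil_linearr b s a t 0; rewrite obil0r !addr0. Qed.
End Obilin.

Section Ohom.
Variables (K : fieldType) (X : fspace K) (A B : omod X) (f : ohom A B).
Variables (U : opens X).
Lemma ohomD (s s' : sec A U) : f U (s + s') = f U s + f U s'.
Proof. by have := ohom_linear f 1 s s'; rewrite !scale1r. Qed.
Lemma ohom0 : f U 0 = 0.
Proof. by apply: (addIr (f U 0)); rewrite -ohomD !add0r. Qed.
Lemma ohomZ a (s : sec A U) : f U (a *: s) = a *: f U s.
Proof. by have := ohom_linear f a s 0; rewrite ohom0 !addr0. Qed.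
End Ohom.

Section Twist.
Variables (K : fieldType) (X : fspace K) (A B : omod X).
Variables (I : Type) (W : I -> opens X).
Hypothesis covW : forall x : X, exists i, W i x.
Variable r : forall i, sec B (W i).
Hypothesis genr : forall i, is_gen (r i).
Implicit Types U V : opens X.

Let V_W V i : opensI V (W i) `<=` V.
Proof. by move=> x []. Qed.
Let VW_W V i : opensI V (W i) `<=` W i.
Proof. by move=> x []. Qed.

(** A concrete substitute for the universal property: over [W i], tensoring with [r i] identifies A
    with T. It is shown below to be equivalent to [is_tensor]. *)
Definition frame_bij (T : omod X) (b : obilin A B T) :=
  forall i V (h : V `<=` W i),
    (forall s s', b V s (res h (r i)) = b V s' (res h (r i)) -> s = s') /\
    (forall t, exists s, b V s (res h (r i)) = t).

Section FrameBij.
Variables (T : omod X) (b : obilin A B T) (P : omod X) (c : obilin A B P).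
Hypothesis bijb : frame_bij b.

(** The graph of the morphism required by the universal property: [y] is the image of [x] if this
    holds in every local expression of [x] as a tensor with some [r i]. *)
Let Q V (x : sec T V) (y : sec P V) := forall i U (h : U `<=` V) (k : U `<=` W i) s,
  res h x = b U s (res k (r i)) -> res h y = c U s (res k (r i)).

Let cov V x : V x -> exists i, opensI V (W i) x.
Proof. by move=> Vx; have [i Wix] := covW x; exists i. Qed.

Let Q_uniq V (x : sec T V) y y' : Q x y -> Q x y' -> y = y'.
Proof.
move=> Qy Qy'; apply: (sec_sep (h := fun i => @V_W V i)) => [z /cov //|i].
have [s sE] := (bijb (@VW_W V i)).2 (res (@V_W V i) x).
by rewrite (Qy i _ _ _ s) ?(Qy' i _ _ _ s) ?sE.
Qed.

Let Q_coh i j U (ki : U `<=` W i) (kj : U `<=` W j) s s' :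
  b U s (res ki (r i)) = b U s' (res kj (r j)) ->
  c U s (res ki (r i)) = c U s' (res kj (r j)).
Proof.
have [d dE] := gen_ex (@genr i) ki (res kj (r j)).
rewrite dE !obilZr -!obilZl => /(bijb ki).1 ->.
by [].
Qed.

Let Q_ex V (x : sec T V) : exists y, Q x y.
Proof.
have /(_ _)/cid s i : exists s, b _ s (res (@VW_W V i) (r i)) = res (@V_W V i) x.
  exact: (bijb _).2.
have sP i := projT2 (s i); set s' := fun i => projT1 (s i).
pose y i := c _ (s' i) (res (@VW_W V i) (r i)).
have yP i U (h : U `<=` opensI V (W i)) (k : U `<=` W i) :
    res h (y i) = c U (res h (s' i)) (res k (r i)).
  by rewrite -obil_res; congr (c _ _ _); exact: res_comp.
have xP i U (h : U `<=` opensI V (W i)) (k : U `<=` W i) (l : U `<=` V) :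
    res l x = b U (res h (s' i)) (res k (r i)).
  by rewrite -(res_comp (@V_W V i) h) -sP -obil_res (res_comp _ _ k).
have [||yy yyP] := @sec_glue _ _ P V I (fun i => opensI V (W i)) (@V_W V) _ y.
- by move=> z /cov.
- move=> i j U hi hj.
  have ki : U `<=` W i by move=> z /hi /VW_W.
  have kj : U `<=` W j by move=> z /hj /VW_W.
  have l : U `<=` V by move=> z /hi /V_W.
  rewrite (yP _ _ _ ki) (yP _ _ _ kj); apply: Q_coh.
  by rewrite -!(xP _ _ _ _ l).
exists yy => i U h k t tE.
have hi : U `<=` opensI V (W i) by move=> z Uz; split; [apply h|apply k].
rewrite -(res_comp (@V_W V i) hi) yyP (yP _ _ _ k); apply: Q_coh.
by rewrite -tE -xP.
Qed.

Let Q_lin V a (x x' : sec T V) y y' : Q x y -> Q x' y' -> Q (a *: x + x') (a *: y + y').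
Proof.
move=> Qy Qy' i U h k s.
have [s1 s1E] := (bijb k).2 (res h x); have [s2 s2E] := (bijb k).2 (res h x').
rewrite !resD !resZ (Qy _ _ _ k s1)// (Qy' _ _ _ k s2)//.
rewrite -s1E -s2E -!obilZl -!obilDl => /esym /(bijb k).1 ->.
by [].
Qed.

Let Q_res V V' (h : V' `<=` V) (x : sec T V) y : Q x y -> Q (res h x) (res h y).
Proof.
move=> Qy i U hU k s; have l : U `<=` V by move=> z /hU /h.
by rewrite !(res_comp _ _ l); exact: Qy.
Qed.

Lemma frame_bij_univ : exists f : ohom T P, forall U s t, f U (b U s t) = c U s t.
Proof.
have fP V x := projT2 (cid (@Q_ex V x)).
set f := fun V x => projT1 (cid (@Q_ex V x)).
have flin V : linear (f V).
  move=> a x x'; apply: Q_uniq; first exact: fP.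
  by apply: Q_lin; exact: fP.
have fres V V' (h : V' `<=` V) x : f V' (res h x) = res h (f V x).
  by apply: Q_uniq; first exact: fP; apply: Q_res; exact: fP.
exists (OHom flin fres) => U s t /=; apply: Q_uniq; first exact: fP.
move=> i U' h k s'; rewrite -!obil_res.
have [d ->] := gen_ex (@genr i) k (res h t).
by rewrite !obilZr -!obilZl => /(bijb k).1 ->.
Qed.
End FrameBij.

Lemma frame_bij_tensor (T : omod X) (b : obilin A B T) : frame_bij b -> is_tensor b.
Proof.
move=> bijb P c; split; first exact: frame_bij_univ.
move=> f g fg U x.
apply: (sec_sep (h := fun i => @V_W U i)) => [z Uz|i].
  by have [i Wz] := covW z; exists i.
have [s sE] := (bijb _ _ (@VW_W U i)).2 (res (@V_W U i) x).
by rewrite -!ohom_res -sE fg.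
Qed.

(* A section x of the tensor product of A and B is encoded by the sections x_i
   of A such that x = x_i (x) r_i on the intersection of V and W_i. *)
Record tw V := Tw {
  twf :> forall i, sec A (opensI V (W i));
  twP : forall i j U (hi : U `<=` opensI V (W i)) (hj : U `<=` opensI V (W j))
    (ki : U `<=` W i) (kj : U `<=` W j) c, res kj (r j) = c *: res ki (r i) ->
    res hi (twf i) = c *: res hj (twf j)
}.

Lemma tw_ext V (x y : tw V) : (forall i, x i = y i) -> x = y.
Proof.
case: x y => [x xP] [y yP] /= xy.
have {}xy : x = y by apply: functional_extensionality_dep.
by subst y; congr Tw; exact: Prop_irrelevance.
Qed.

HB.instance Definition _ V := gen_eqMixin (tw V).
HB.instance Definition _ V := gen_choiceMixin (tw V).

Definition tw0 V : tw V.
Proof.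
by exists (fun i => 0) => i j U hi hj ki kj c _; rewrite !res0 scaler0.
Defined.
Definition twadd V (x y : tw V) : tw V.
Proof.
exists (fun i => x i + y i) => i j U hi hj ki kj c e.
by rewrite !resD (twP _ hi hj e) (twP _ hi hj e) scalerDr.
Defined.
Definition twopp V (x : tw V) : tw V.
Proof.
exists (fun i => - x i) => i j U hi hj ki kj c e.
by rewrite !resN (twP _ hi hj e) scalerN.
Defined.
Definition twscale V (a : oring V) (x : tw V) : tw V.
Proof.
exists (fun i => ores (@V_W V i) a *: x i) => i j U hi hj ki kj c e.
have l : U `<=` V by move=> z /hi [].
by rewrite !resZ (twP _ hi hj e) !(ores_comp _ _ l) !scalerA mulrC.
Defined.

Lemma twaddA V : associative (@twadd V).
Proof. by move=> x y z; apply: tw_ext => i /=; rewrite addrA. Qed.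
Lemma twaddC V : commutative (@twadd V).
Proof. by move=> x y; apply: tw_ext => i /=; rewrite addrC. Qed.
Lemma tw0add V : left_id (@tw0 V) (@twadd V).
Proof. by move=> x; apply: tw_ext => i /=; rewrite add0r. Qed.
Lemma twNadd V : left_inverse (@tw0 V) (@twopp V) (@twadd V).
Proof. by move=> x; apply: tw_ext => i /=; rewrite addNr. Qed.

HB.instance Definition _ V :=
  GRing.isZmodule.Build (tw V) (@twaddA V) (@twaddC V) (@tw0add V) (@twNadd V).

Lemma twscaleA V a a' (x : tw V) : twscale a (twscale a' x) = twscale (a * a') x.
Proof. by apply: tw_ext => i /=; rewrite scalerA oresM. Qed.
Lemma twscale1 V : left_id 1 (@twscale V).
Proof. by move=> x; apply: tw_ext => i /=; rewrite ores1 scale1r. Qed.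
Lemma twscaleDr V : right_distributive (@twscale V) +%R.
Proof. by move=> a x y; apply: tw_ext => i /=; rewrite scalerDr. Qed.
Lemma twscaleDl V x : {morph (@twscale V)^~ x : a b / a + b}.
Proof. by move=> a a'; apply: tw_ext => i /=; rewrite oresD scalerDl. Qed.

HB.instance Definition _ V := GRing.Zmodule_isLmodule.Build (oring V) (tw V)
  (@twscaleA V) (@twscale1 V) (@twscaleDr V) (@twscaleDl V).

Let VW_sub U V i (h : V `<=` U) : opensI V (W i) `<=` opensI U (W i).
Proof. by move=> x [/h]. Qed.

Definition twres U V (h : V `<=` U) (x : tw U) : tw V.
Proof.
exists (fun i => res (VW_sub (i := i) h) (x i)) => i j U' hi hj ki kj c e.
have li : U' `<=` opensI U (W i) by move=> z /hi /VW_sub; exact.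
have lj : U' `<=` opensI U (W j) by move=> z /hj /VW_sub; exact.
by rewrite (res_comp _ _ li) (res_comp _ _ lj); exact: twP e.
Defined.

Definition twist : omod X.
Proof.
refine (@OMod _ X (fun V => tw V) twres _ _ _ _ _ _).
- by move=> U V h s s'; apply: tw_ext => i /=; rewrite resD.
- move=> U V h a s; apply: tw_ext => i /=; rewrite resZ; congr (_ *: _).
  have l : opensI V (W i) `<=` U by move=> z [/h].
  by rewrite !(ores_comp _ _ l).
- by move=> U h s; apply: tw_ext => i /=; exact: res_id.
- by move=> U V V' h h' h'' s; apply: tw_ext => i /=; exact: res_comp.
- move=> U J V h cov s s' ss'; apply: tw_ext => i.
  apply: (sec_sep (h := fun j => VW_sub (i := i) (h j))) => [x [/cov[j Vx] Wx]|j].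
    by exists j.
  exact: (congr1 (fun x : tw _ => x i) (ss' j)).
- move=> U J V h cov s coh.
  have sP i j k (V' : opens X) (hj : V' `<=` opensI (V j) (W i)) (hk : V' `<=` opensI (V k) (W i)) :
      res hj (s j i) = res hk (s k i).
    have lj : V' `<=` V j by move=> z /hj [].
    have lk : V' `<=` V k by move=> z /hk [].
    have m : V' `<=` opensI V' (W i) by move=> z V'z; split=> //; case: (hj _ V'z).
    have /(congr1 (fun x : tw _ => res m (x i))) /= := coh j k _ lj lk.
    by rewrite (res_comp _ _ hj) (res_comp _ _ hk).
  have ex i : exists y, forall j, res (VW_sub (i := i) (h j)) y = s j i.
    apply: sec_glue => [x [/cov[j Vx] Wx]|j k V']; first by exists j.
    exact: sP.
  have yP i := projT2 (cid (ex i)); set y := fun i => projT1 (cid (ex i)).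
  unshelve eexists.
    exists y => i j V' hi hj ki kj c e.
    pose Vk k := opensI V' (V k).
    have hk k : Vk k `<=` V' by move=> ? [].
    apply: (sec_sep (h := hk)) => [x V'x|k].
      by have [k Vx] := cov _ (hi _ V'x).1; exists k.
    have li : Vk k `<=` opensI (V k) (W i) by move=> z [/ki].
    have lj : Vk k `<=` opensI (V k) (W j) by move=> z [/kj].
    have mi : Vk k `<=` opensI U (W i) by move=> z /hk /hi.
    have mj : Vk k `<=` opensI U (W j) by move=> z /hk /hj.
    rewrite resZ (res_comp _ _ mi) (res_comp _ _ mj).
    rewrite -(res_comp (VW_sub (h k)) li) -(res_comp (VW_sub (h k)) lj) !yP.
    have ni : Vk k `<=` W i by move=> z /hk /ki.
    have nj : Vk k `<=` W j by move=> z /hk /kj.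
    apply: (twP _ li lj (ki := ni) (kj := nj)).
    by have := congr1 (res (hk k)) e; rewrite resZ (res_comp _ _ ni) (res_comp _ _ nj).
  by move=> j; apply: tw_ext => i /=; exact: yP.
Defined.

Let coef_ex V (e : sec B V) i : exists c, res (@V_W V i) e = c *: res (@VW_W V i) (r i).
Proof. exact: gen_ex. Qed.
Definition coef V (e : sec B V) i := projT1 (cid (coef_ex e i)).
Lemma coefP V (e : sec B V) i :
  res (@V_W V i) e = coef e i *: res (@VW_W V i) (r i).
Proof. exact: projT2 (cid (coef_ex e i)). Qed.

Definition twb_fun V (s : sec A V) (e : sec B V) : sec twist V.
Proof.
exists (fun i => coef e i *: res (@V_W V i) s) => i j U hi hj ki kj c cE.
have l : U `<=` V by move=> z /hi [].
rewrite !resZ !(res_comp _ _ l) scalerA; congr (_ *: _).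
apply: (gen_uniq (@genr i) (h := ki)).
rewrite mulrC -scalerA -cE.
rewrite -(res_comp (@VW_W V i) hi ki) -(res_comp (@VW_W V j) hj kj) -!resZ -!coefP.
by rewrite !(res_comp _ _ l).
Defined.

Definition twb : obilin A B twist.
Proof.
refine (@OBilin _ _ _ _ _ twb_fun _ _ _).
- move=> U s a t t'; apply: tw_ext => i /=.
  rewrite scalerA -scalerDl; congr (_ *: _).
  apply: (gen_uniq (@genr i) (h := @VW_W U i)).
  by rewrite -coefP resD resZ !coefP scalerDl scalerA.
- move=> U t a s s'; apply: tw_ext => i /=.
  by rewrite resD resZ scalerDr !scalerA mulrC.
- move=> U V h s t; apply: tw_ext => i /=.
  have l : opensI V (W i) `<=` U by move=> z [/h].
  rewrite resZ !(res_comp _ _ l); congr (_ *: _).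
  apply: (gen_uniq (@genr i) (h := @VW_W V i)).
  rewrite -coefP (res_comp _ _ l) -(res_comp (@VW_W U i) (VW_sub h)) -resZ -coefP.
  by rewrite (res_comp _ _ l).
Defined.

Lemma twb_bij : frame_bij twb.
Proof.
move=> i V h; have m : V `<=` opensI V (W i) by move=> x Vx; split=> //; exact: h.
have hid : V `<=` V by [].
split=> [s s' /(congr1 (fun x : tw _ => res m (x i))) /=|x].
  have c1 : coef (res h (r i)) i = 1.
    apply: (gen_uniq (@genr i) (h := @VW_W V i)).
    by rewrite -coefP scale1r; exact: res_comp.
  by rewrite c1 !scale1r !(res_comp _ _ hid) !res_id.
exists (res m (x i)); apply: tw_ext => j /=.
have l : opensI V (W j) `<=` opensI V (W i) by move=> z [/m].
have lid : opensI V (W j) `<=` opensI V (W j) by [].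
have k : opensI V (W j) `<=` W i by move=> z [/h].
rewrite (res_comp _ _ l) -[RHS](res_id lid); symmetry.
apply: (twP x lid l (ki := @VW_W V j) (kj := k)).
by rewrite -coefP; symmetry; exact: res_comp.
Qed.

Lemma tensor_ex : exists (T : omod X) (b : obilin A B T), is_tensor b.
Proof. by exists twist, twb; apply: frame_bij_tensor; exact: twb_bij. Qed.

(** The universal properties of T and of the explicit model [twist] give maps in both directions
    whose composite on T is the identity, by uniqueness; the bijectivity known for [twb] is carried
    over along them. *)
Lemma tensor_frame_bij (T : omod X) (b : obilin A B T) : is_tensor b -> frame_bij b.
Proof.
move=> tb; have [[f fb] _] := tb _ twb.
have [[g gb] _] := frame_bij_tensor twb_bij b.
have id_lin (U : opens X) : linear (fun s : sec T U => s) by [].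
have id_res (U V : opens X) (h : V `<=` U) (s : sec T U) : res h s = res h s by [].
have gf_lin U : linear (fun s : sec T U => g U (f U s)).
  by move=> a s t; rewrite !(ohomD, ohomZ).
have gf_res U V (h : V `<=` U) (s : sec T U) : g V (f V (res h s)) = res h (g U (f U s)).
  by rewrite !ohom_res.
have gfK U (x : sec T U) : g U (f U x) = x.
  apply: ((tb _ b).2 (OHom gf_lin gf_res) (OHom id_lin id_res)) => V s t /=.
  by rewrite fb gb.
move=> i V h; have [inj surj] := twb_bij h; split=> [s s' e|t].
  by apply: inj; rewrite -!fb e.
by have [s sE] := surj (f V t); exists s; rewrite -[t]gfK -sE gb.
Qed.

End Twist.

(** * Direct images under the double cover *)

Definition cv2 (S : Type) (a b : S) : 'cV[S]_2 := \col_i (if i == 0 then a else b).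

Lemma cv2P (S : Type) (v : 'cV[S]_2) : v = cv2 (v 0 0) (v 1 0).
Proof.
apply/matrixP => i j; rewrite !mxE (ord1 j).
have [->//|] := eqVneq i 0; case: i => [[|[|//]]] //= lt _.
by congr (v _ _); exact/val_inj.
Qed.

Lemma cv2_inj (S : Type) (a b c d : S) : cv2 a b = cv2 c d -> a = c /\ b = d.
Proof. by move=> /matrixP e; have := e 0 0; have := e 1 0; rewrite !mxE. Qed.

Lemma map_mx2 (S S' : Type) (g : S -> S') (a b c d : S) :
  map_mx g (mx2 a b c d) = mx2 (g a) (g b) (g c) (g d).
Proof. by apply/matrixP => i j; rewrite !mxE; case: (i == 0); case: (j == 0). Qed.

Section TwoByTwo.
Variable S : comPzRingType.
Implicit Types (a b c d : S) (v : 'cV[S]_2).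

Lemma mx2_mulcv a b c d x y :
  mx2 a b c d *m cv2 x y = cv2 (a * x + b * y) (c * x + d * y).
Proof.
apply/matrixP => i j; rewrite !mxE big_ord_recl big_ord1 !mxE /=.
by case: (i == 0).
Qed.

Lemma mx2M a b c d a' b' c' d' :
  mx2 a b c d *m mx2 a' b' c' d' =
  mx2 (a * a' + b * c') (a * b' + b * d') (c * a' + d * c') (c * b' + d * d').
Proof.
apply/matrixP => i j; rewrite !mxE !big_ord_recl big_ord0 !mxE /= addr0.
by case: (i == 0); case: (j == 0).
Qed.

Lemma mulmx_cv2 (G : 'M[S]_2) x y :
  G *m cv2 x y = cv2 (G 0 0 * x + G 0 1 * y) (G 1 0 * x + G 1 1 * y).
Proof.
rewrite -mx2_mulcv; congr (_ *m _); apply/matrixP => i j; rewrite !mxE.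
by case: i => [[|[|//]]] lti /=; case: j => [[|[|//]]] ltj /=;
  congr (G _ _); exact/val_inj.
Qed.

Lemma cv2D a b c d : cv2 a b + cv2 c d = cv2 (a + c) (b + d).
Proof. by apply/matrixP => i j; rewrite !mxE; case: (i == 0). Qed.

Lemma cv2Z a b c : a *: cv2 b c = cv2 (a * b) (a * c).
Proof. by apply/matrixP => i j; rewrite !mxE; case: (i == 0). Qed.

Lemma det2 (G : 'M[S]_2) : \det G = G 0 0 * G 1 1 - G 0 1 * G 1 0.
Proof.
rewrite (expand_det_row _ 0) !big_ord_recl big_ord0 /cofactor !det_mx11 !mxE /=.
rewrite !expr0 expr1 mul1r mulN1r addr0 mulrN.
by congr (_ * _ - _ * _); congr (G _ _); exact/val_inj.
Qed.

End TwoByTwo.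

Lemma gen_triv (K : fieldType) (X : fspace K) (A : omod X) (U : opens X)
  (e : sec A U) : is_gen e -> inhabited (triv A U 1).
Proof.
move=> ge.
pose c (V : opens X) (h : V `<=` U) s := projT1 (cid (gen_ex ge h s)).
have cP (V : opens X) (h : V `<=` U) s : s = c V h s *: res h e := projT2 (cid (gen_ex ge h s)).
have c_eq (V : opens X) (h : V `<=` U) s d : s = d *: res h e -> c V h s = d.
  by move=> sE; apply: (gen_uniq ge (h := h)); rewrite -cP.
pose t (V : opens X) (h : V `<=` U) s : 'cV[oring V]_1 := const_mx (c V h s).
have tlin (V : opens X) (h : V `<=` U) : linear (t V h).
  move=> a s s'; apply/matrixP => i j; rewrite !mxE; apply: c_eq.
  by rewrite {1}(cP _ h s) {1}(cP _ h s') scalerDl scalerA.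
have tbij (V : opens X) (h : V `<=` U) : bijective (t V h).
  exists (fun v : 'cV[oring V]_1 => v 0 0 *: res h e) => [s|v]; first by rewrite mxE -cP.
  by apply/matrixP => i j; rewrite !ord1 mxE; exact: c_eq.
have tres (V W : opens X) (h : V `<=` U) (h' : W `<=` V) (h'' : W `<=` U) s :
    t W h'' (res h' s) = map_mx (ores h') (t V h s).
  apply/matrixP => i j; rewrite !mxE; apply: c_eq.
  by rewrite {1}(cP _ h s) resZ (res_comp _ _ h'').
by constructor; exact: (Triv tlin tbij tres).
Qed.

Section Triv.
Variables (K : fieldType) (X : fspace K) (A : omod X) (U : opens X) (n : nat).
Variables (phi : triv A U n) (V : opens X) (h : V `<=` U).
Lemma trivD s s' : phi V h (s + s') = phi V h s + phi V h s'.
Proof. by have := triv_linear phi h 1 s s'; rewrite !scale1r. Qed.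
Lemma triv0 : phi V h 0 = 0.
Proof. by apply: (addIr (phi V h 0)); rewrite -trivD !add0r. Qed.
Lemma trivZ a s : phi V h (a *: s) = a *: phi V h s.
Proof. by have := triv_linear phi h a s 0; rewrite triv0 !addr0. Qed.
End Triv.

Section DoubleCover.
Variables (K : fieldType) (X Y : fspace K) (f : fmorph X Y) (D : cover_data f).
Implicit Types (V W : opens Y).

Lemma opullZ0 V : opull f (0 : oring V) = 0.
Proof. exact: oring_ext. Qed.
Lemma opull_res V W (h : W `<=` V) (a : oring V) :
  opull f (ores h a) = ores (opre_sub (f := f) h) (opull f a).
Proof. by apply: oring_ext => x /=; congr (ofun a _); exact/val_inj. Qed.

(** The value of [dt] is retyped as a function on the inverse image of V, where it can be
    multiplied. *)
Definition tsec V (e : sec (dL D) V) : oring (opre f V) := dt D V e.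

Lemma tsecZ V a (e : sec (dL D) V) : tsec (a *: e) = opull f a * tsec e.
Proof. exact: (ohomZ (dt D) a e). Qed.
Lemma tsecD V (e e' : sec (dL D) V) : tsec (e + e') = tsec e + tsec e'.
Proof. exact: (ohomD (dt D) e e'). Qed.
Lemma tsec_res V W (h : W `<=` V) (e : sec (dL D) V) :
  tsec (res h e) = ores (opre_sub h) (tsec e).
Proof. exact: (ohom_res (dt D) h e). Qed.
Lemma tsec_sqr V (e e' : sec (dL D) V) : tsec e * tsec e' = opull f (Fval e e').
Proof. by have := dt_sqr e e'. Qed.
Lemma Fval_res V W (h : W `<=` V) (e e' : sec (dL D) V) :
  Fval (res h e) (res h e') = ores h (Fval e e').
Proof. by rewrite /Fval obil_res ohom_res. Qed.

Section Decomposition.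
Variables (V : opens Y) (e : sec (dL D) V).
Hypothesis ge : is_gen e.

Definition lin (a b : oring V) := opull f a + opull f b * tsec e.

Lemma lin_ex (w : oring (opre f V)) : exists a b, w = lin a b.
Proof.
have [[a e'] [/= wE _]] := dt_split D w.
have hid : V `<=` V by [].
have [b bE] := gen_ex ge hid e'; exists a, b.
by rewrite /lin -tsecZ -[X in _ *: X](res_id hid) -bE.
Qed.

Lemma lin_inj a b a' b' : lin a b = lin a' b' -> a = a' /\ b = b'.
Proof.
rewrite /lin -!tsecZ => ww.
have [ae [_ ae_uniq]] := dt_split D (lin a b).
have e1 := ae_uniq (a, b *: e); have e2 := ae_uniq (a', b' *: e).
have [] : (a, b *: e) = (a', b' *: e).
  rewrite -e1 ?e2// /lin -?tsecZ//.
move=> -> be; split=> //; have hid : V `<=` V by [].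
by apply: (gen_uniq ge (h := hid)); rewrite res_id.
Qed.

Lemma linM a b a' b' :
  lin a b * lin a' b' = lin (a * a' + b * b' * Fval e e) (a * b' + b * a').
Proof.
rewrite /lin !opullD !opullM -tsec_sqr; ring.
Qed.
End Decomposition.

Section Generation.
Hypothesis finf : finite_morph f.
Hypothesis affgen : forall (A : omod X) (Z : opens X) x, line_bundle A ->
  is_affine Z -> Z x -> exists s : sec A Z, gen_at s x.

(* A section over f^-1(V) through which all sections over the saturated open
   sets factor cannot vanish, as A is globally generated on affine open sets. *)
Lemma push_gen (A : omod X) V (s : sec A (opre f V)) : line_bundle A ->
  (forall W (h : W `<=` V) (t : sec A (opre f W)),
     exists w, t = w *: res (opre_sub h) s) -> is_gen s.
Proof.
move=> lineA sur; apply: gen_local => x Vx.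
have [V' [V'x affV' affpre _]] := finf (f x).
(* Finiteness of [f] makes the inverse image [Z] of V' affine. Its sections are restricted to the
   inverse image of [W], a saturated open set, where the factorization hypothesis applies. *)
pose Z := Opens affpre.1; pose W := opensI V (Opens affV'.1).
have [t gt] := affgen (Z := Z) lineA affpre V'x.
have h : W `<=` V by move=> ? [].
have hZ : opre f W `<=` Z by move=> ? [].
have [w tE] := sur W h (res hZ t).
exact: gen_at_factor tE gt.
Qed.
End Generation.

(** * Cocycles of line bundles on X over the inverse images of the covering *)

Section Frames.
Variables (I : Type) (U : adapted_cover D I).
Local Notation U2 i j := (opensI (acov U i) (acov U j)).

Let U2l i j : U2 i j `<=` U i.
Proof. by move=> x []. Qed.
Let U2r i j : U2 i j `<=` U j.
Proof. by move=> x []. Qed.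

Let Xcov : forall x : X, exists i, opre f (U i) x.
Proof. by move=> x; exact: acov_cover. Qed.

Let gen_U i : is_gen (agen U i).
Proof. exact: agen_gen. Qed.

Definition transition := forall i j, oring (opre f (U2 i j)).

Definition frame (A : omod X) (u : transition) :=
  exists s : forall i, sec A (opre f (U i)), (forall i, is_gen (s i)) /\
    forall i j (hi : opre f (U2 i j) `<=` opre f (U i))
      (hj : opre f (U2 i j) `<=` opre f (U j)),
      res hj (s j) = u i j *: res hi (s i).

Lemma frame_line_bundle A u : frame A u -> line_bundle A.
Proof.
move=> [s [gs _]] x; have [i Uix] := Xcov x.
by exists (opre f (U i)); split=> //; exact: (gen_triv (gs i)).
Qed.

Lemma frame_O (T : omod X) : oisom T (O_mod X) -> frame T (fun i j => 1).
Proof.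
move=> [p [q [qp pq]]]; exists (fun i => q _ (1 : oring (opre f (U i)))).
have r1 i (V : opens X) (h : V `<=` opre f (U i)) : res h (q _ (1 : oring (opre f (U i)))) = q V (1 : oring V).
  rewrite -ohom_res; congr (q _ _); exact: ores1.
split=> [i|i j hi hj]; last by rewrite !r1 scale1r.
have qZ (V : opens X) (c : oring V) : c *: q V (1 : oring V) = q V c.
  by rewrite -ohomZ; congr (q _ _); exact: mulr1.
apply: is_genP => V h s.
  by exists (p V s : oring V); rewrite /= r1 qZ qp.
rewrite /= r1 qZ => /(congr1 (p V)).
by rewrite pq ohom0.
Qed.

Lemma tensor_gen (A B T : omod X) (b : obilin A B T)
    (s : forall i, sec A (opre f (U i))) (r : forall i, sec B (opre f (U i))) :
  is_tensor b -> (forall i, is_gen (s i)) -> (forall i, is_gen (r i)) ->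
  forall i, is_gen (b _ (s i) (r i)).
Proof.
move=> tb gs gr i; have bij := tensor_frame_bij Xcov gr tb.
apply: is_genP => V h x.
  have [t <-] := (bij _ _ h).2 x; have [c ->] := gen_ex (gs i) h t.
  by exists c; rewrite obilZl obil_res.
rewrite -obil_res -obilZl -(obil0l b (res h (r i))) => /(bij _ _ h).1.
exact: gen_eq0.
Qed.

Lemma frame_tensor (A B T : omod X) u v : frame A u -> frame B v ->
  tensor_of A B T -> frame T (fun i j => u i j * v i j).
Proof.
move=> [s [gs sE]] [r [gr rE]] [b tb].
exists (fun i => b _ (s i) (r i)); split; first exact: tensor_gen.
move=> i j hi hj.
by rewrite -!obil_res (sE _ _ hi) (rE _ _ hi) obilZl obilZr scalerA.
Qed.

(* The generators r_i of B are chosen to pair with those of A to a_i rather than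
   to 1: this changes the transition functions by the coboundary a_j / a_i. *)
Lemma frame_inverse (A B : omod X) u v (a : forall i, oring (opre f (U i))) :
  frame A u -> inverse_of A B -> (forall i, is_ounit (a i)) ->
  (forall i j (hi : opre f (U2 i j) `<=` opre f (U i))
      (hj : opre f (U2 i j) `<=` opre f (U j)),
     v i j * u i j * ores hi (a i) = ores hj (a j)) ->
  frame B v.
Proof.
move=> [s [gs sE]] [_ [b tb]] ua vE.
have bij := tensor_frame_bij Xcov gs tb.
have hid i : opre f (U i) `<=` opre f (U i) by [].
have rex i : exists r, b _ r (s i) = a i.
  have [r rE] := (bij i _ (hid i)).2 (a i); exists r.
  by rewrite -rE res_id.
pose r i := projT1 (cid (rex i)); have rP i : b _ (r i) (s i) = a i := projT2 (cid (rex i)).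
have rP' i (V : opens X) (h : V `<=` opre f (U i)) : b _ (res h (r i)) (res h (s i)) = ores h (a i).
  by rewrite obil_res rP.
exists r; split=> [i|i j hi hj].
  apply: is_genP => V h t.
    have [d da] := ounit_res h (ua i).
    exists ((b V t (res h (s i)) : oring V) * d); apply: (bij _ _ h).1.
    rewrite obilZl rP' -[LHS]mulr1 -da; symmetry.
    rewrite (mulrC (ores h _)) mulrA; exact: erefl.
  move=> /(congr1 (fun x => b V x (res h (s i)) : oring V)).
  rewrite obilZl rP' obil0l => ta; have [d da] := ounit_res h (ua i).
  have {}ta : t * ores h (a i) = 0 := ta.
  by rewrite -[t]mulr1 -da mulrA ta mul0r.
apply: (bij _ _ hj).1; rewrite rP' -(vE i j hi hj) (sE i j hi hj).
rewrite obilZr obilZl rP'; change (v i j * u i j * ores hi (a i) =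
   u i j * (v i j * ores hi (a i))); ring.
Qed.

Lemma frame_exp (A T : omod X) u n : frame A u -> tensor_exp A n T ->
  frame T (fun i j => u i j ^+ n).
Proof.
move=> fA; elim: n T => [|n IH] T /=; first exact: frame_O.
move=> [P [/IH fP tT]].
have := frame_tensor fP fA tT; congr frame.
by apply/functional_extensionality_dep => i; apply/functional_extensionality_dep => j; rewrite exprSr.
Qed.

Lemma frame_prod m (A : 'I_m -> omod X) T (u : 'I_m -> transition) :
  (forall k, frame (A k) (u k)) -> tensor_prod A T ->
  frame T (fun i j => \prod_(k < m) u k i j).
Proof.
elim: m A T u => [|m IH] A T u fA /=.
  move=> /frame_O; congr frame.
  by apply/functional_extensionality_dep => i; apply/functional_extensionality_dep => j; rewrite big_ord0.
move=> [P [/IH IHP tT]].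
have fP := IHP (fun k => u (widen_ord (leqnSn m) k)) (fun k => fA _).
have := frame_tensor fP (fA ord_max) tT; congr frame.
by apply/functional_extensionality_dep => i; apply/functional_extensionality_dep => j; rewrite big_ord_recr.
Qed.

Section LinTriv.
Variables (A : omod X) (V : opens Y) (e : sec (dL D) V) (s : sec A (opre f V)).
Hypotheses (ge : is_gen e) (gs : is_gen s).

Lemma lin_res W W' (h : W' `<=` W) (c : sec (dL D) W) a b :
  ores (opre_sub h) (lin c a b) = lin (res h c) (ores h a) (ores h b).
Proof. by rewrite /lin oresD oresM -!opull_res tsec_res. Qed.

Lemma lin_lin W (c : sec (dL D) W) k a b a' b' :
  opull f k * lin c a b + lin c a' b' = lin c (k * a + a') (k * b + b').
Proof. by rewrite /lin !opullD !opullM; ring. Qed.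

(** The sections 1 and t e form a basis of the direct image of O_X over [V]; multiplying them by the
    generator [s] gives a basis of the direct image of A. *)
Lemma lin_triv : exists phi : triv (push f A) V 2,
  forall W (h : W `<=` V) a b,
    phi W h (lin (res h e) a b *: res (opre_sub h) s) = cv2 a b.
Proof.
have ex W (h : W `<=` V) (t : sec A (opre f W)) :
    exists ab, t = lin (res h e) ab.1 ab.2 *: res (opre_sub h) s.
  have [w ->] := gen_ex gs (opre_sub h) t.
  by have [a [b ->]] := lin_ex (gen_res h ge) w; exists (a, b).
pose c W h t := projT1 (cid (ex W h t)).
have cP W h t : t = lin (res h e) (c W h t).1 (c W h t).2 *: res (opre_sub h) s :=
  projT2 (cid (ex W h t)).
pose p W (h : W `<=` V) (t : sec (push f A) W) := cv2 (c W h t).1 (c W h t).2.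
have p_eq W (h : W `<=` V) a b : p W h (lin (res h e) a b *: res (opre_sub h) s) = cv2 a b.
  have /esym/(gen_uniq gs) := cP W h (lin (res h e) a b *: res (opre_sub h) s).
  by rewrite /p => /(lin_inj (gen_res h ge))[-> ->].
have plin W (h : W `<=` V) : linear (p W h).
  move=> k t t'.
  have -> : k *: t + t' = lin (res h e) (k * (c W h t).1 + (c W h t').1)
      (k * (c W h t).2 + (c W h t').2) *: res (opre_sub h) s.
    rewrite -lin_lin scalerDl -scalerA -!cP; exact: erefl.
  by rewrite p_eq /p cv2Z cv2D.
have pbij W (h : W `<=` V) : bijective (p W h).
  exists (fun v : 'cV[oring W]_2 => lin (res h e) (v 0 0) (v 1 0) *: res (opre_sub h) s) => [t|v].
    by rewrite !mxE /= -cP.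
  by rewrite p_eq -cv2P.
have pres W W' (h : W `<=` V) (h' : W' `<=` W) (h'' : W' `<=` V) t :
    p W' h'' (res h' t) = map_mx (ores h') (p W h t).
  have -> : res h' t = lin (res h'' e) (ores h' (c W h t).1) (ores h' (c W h t).2)
      *: res (opre_sub h'') s.
    rewrite -(res_comp h h' h'') -lin_res.
    rewrite -(res_comp (opre_sub h) (opre_sub h') (opre_sub h'')) -resZ -cP.
    exact: erefl.
  by rewrite p_eq; apply/matrixP => i j; rewrite !mxE; case: (i == 0).
by exists (Triv plin pbij pres).
Qed.
End LinTriv.

Local Notation tl i j := (res (@U2l i j) (agen U i)).
Local Notation Fl i j := (resl j (Floc U i)).

Lemma Fval_tl i j : Fval (tl i j) (tl i j) = Fl i j.
Proof. by rewrite Fval_res; congr (ores _ _); exact: Prop_irrelevance. Qed.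

(* M is the matrix of the multiplication by w in the basis 1, t_i of f_* O_X *)
Definition mulmat i j (M : 'M[oring (U2 i j)]_2) (w : oring (opre f (U2 i j))) :=
  exists a b, M = a *: 1%:M + b *: map_mx (@resl _ _ _ _ _ _ U i j) (M0 U i)
              /\ w = lin (tl i j) a b.

Lemma mulmatE i j (a b : oring (U2 i j)) :
  a *: 1%:M + b *: map_mx (@resl _ _ _ _ _ _ U i j) (M0 U i) =
  mx2 a (b * Fl i j) b a.
Proof.
apply/matrixP => k l; rewrite !mxE.
case: k => [[|[|//]]] ltk /=; case: l => [[|[|//]]] ltl /=.
- by rewrite mulr1 /resl ores0 mulr0 addr0.
- by rewrite mulr0 add0r.
- by rewrite mulr0 add0r /resl ores1 mulr1.
- by rewrite mulr1 /resl ores0 mulr0 addr0.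
Qed.

Lemma mulmat1 i j : mulmat (1%:M : 'M[oring (U2 i j)]_2) 1.
Proof.
exists 1, 0; rewrite scale1r scale0r addr0; split=> //.
by rewrite /lin opull1 opullZ0 mul0r addr0.
Qed.

(** The square of [M0] is F_i times the identity, just as t_i^2 = F_i. *)
Lemma mulmatM i j (M M' : 'M[oring (U2 i j)]_2) w w' :
  mulmat M w -> mulmat M' w' -> mulmat (M *m M') (w * w').
Proof.
move=> [a [b [-> ->]]] [a' [b' [-> ->]]].
exists (a * a' + b * b' * Fl i j), (a * b' + b * a').
rewrite linM Fval_tl !mulmatE; split=> //.
apply/matrixP => k l; rewrite !mxE !big_ord_recl big_ord0 !mxE.
by case: k => [[|[|//]]] ltk /=; case: l => [[|[|//]]] ltl /=; ring.
Qed.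

Lemma mulmatX i j (M : 'M[oring (U2 i j)]_2) w n : mulmat M w -> mulmat (M ^+ n) (w ^+ n).
Proof.
move=> Mw; elim: n => [|n IH]; first by rewrite !expr0; exact: mulmat1.
by rewrite !exprS; exact: mulmatM.
Qed.

Lemma mulmat_prod i j m (M : 'I_m -> 'M[oring (U2 i j)]_2) w :
  (forall k, mulmat (M k) (w k)) -> mulmat (\prod_k M k) (\prod_k w k).
Proof.
move=> Mw; elim: m M w Mw => [|m IH] M w Mw.
  by rewrite !big_ord0; exact: mulmat1.
by rewrite !big_ord_recr /=; apply: mulmatM => //; exact: IH.
Qed.

Definition mult_fun (A : omod X) V (s : sec (push f A) V) (e : sec (dL D) V) :
  sec (push f A) V := tsec e *: (s : sec A (opre f V)).

(** The morphism M_A of the pair attached to A is the one that this bilinear map induces on the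
    tensor product. *)
Definition mult (A : omod X) : obilin (push f A) (dL D) (push f A).
Proof.
refine (@OBilin _ _ _ _ _ (@mult_fun A) _ _ _).
- move=> V s a e e'; rewrite /mult_fun tsecD tsecZ scalerDl -scalerA; exact: erefl.
- move=> V e a s s'; rewrite /mult_fun.
  change (tsec e *: (opull f a *: (s : sec A (opre f V)) + s') =
    opull f a *: (tsec e *: (s : sec A (opre f V))) + tsec e *: (s' : sec A (opre f V))).
  by rewrite scalerDr !scalerA mulrC.
- move=> V W h s e; rewrite /mult_fun tsec_res.
  symmetry; exact: (resZ (opre_sub h) (tsec e) (s : sec A (opre f V))).
Defined.

Lemma axi_tsec i j W (hi : W `<=` U i) (hj : W `<=` U j) (hij : W `<=` U2 i j) :
  tsec (res hj (agen U j)) = opull f (ores hij (axi U i j)) * tsec (res hi (agen U i)).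
Proof.
rewrite -tsecZ -(res_comp (@U2l i j) hij hi) -(res_comp (@U2r i j) hij hj).
by rewrite (axi_trans (@U2l i j)) resZ.
Qed.

Lemma lin_scale V (e e' : sec (dL D) V) k a b : tsec e' = opull f k * tsec e ->
  lin e' a b = lin e a (b * k).
Proof. by move=> ee'; rewrite /lin ee' opullM mulrA. Qed.

Lemma lin_tsec V (e : sec (dL D) V) a b : tsec e * lin e a b = lin e (b * Fval e e) a.
Proof. by rewrite /lin opullM -tsec_sqr; ring. Qed.

(** In the bases s_i, t_i s_i the multiplication by t_i sends a + c t_i to c F_i + a t_i, which is
    [M0]. Passing from index j to i substitutes t_j = xi_ij t_i, which is [G0], and s_j = w_ij s_i,
    which is [M i j]. *)
Lemma frame_pair (A : omod X) w (M : gluing U) : frame A w ->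
  (forall i j, mulmat (M i j) (w i j)) ->
  exists q : pair D, [/\ admissible q,
    is_rep q (fun i j => M i j *m G0 U i j) (M0 U) & associated A q].
Proof.
move=> fA Mw; have lineA := frame_line_bundle fA; have [s [gs sE]] := fA.
have [T [b tb]] := tensor_ex (push f A) (acov_cover U) gen_U.
have [[MA MAE] _] := tb _ (mult A).
have {}MAE V (t : sec A (opre f V)) (e : sec (dL D) V) : MA V (b V t e) = tsec e *: t.
  exact: MAE.
have /(_ _)/cid phi i := lin_triv (@gen_U i) (gs i).
pose ph i := projT1 (phi i).
have phE i W (h : W `<=` U i) a c :
    ph i W h (lin (res h (agen U i)) a c *: res (opre_sub h) (s i)) = cv2 a c.
  exact: (projT2 (phi i) W h a c).
have ph_ex i W (h : W `<=` U i) (t : sec A (opre f W)) :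
    exists a c, t = lin (res h (agen U i)) a c *: res (opre_sub h) (s i).
  have [d ->] := gen_ex (gs i) (opre_sub h) t.
  by have [a [c ->]] := lin_ex (gen_res h (@gen_U i)) d; exists a, c.
exists (Pair b MA); split.
- split=> //=.
    by move=> y; have [i Uiy] := acov_cover U y; exists (U i); split=> //; constructor; exact: (ph i).
  move=> V t e e'; rewrite !MAE scalerA (mulrC (tsec e')) tsec_sqr; exact: erefl.
- exists ph; split=> /= [i j W hi hj hij t|i W h t].
    have [a [c tE]] := ph_ex j W hj t; rewrite [X in ph j W hj X]tE phE.
    have [al [be [ME wE]]] := Mw i j.
    pose r := @ores _ _ (U2 i j) W hij.
    have sjE : res (opre_sub hj) (s j) =
        lin (res hi (agen U i)) (r al) (r be) *: res (opre_sub hi) (s i).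
      have := congr1 (res (@opre_sub _ _ _ f (U2 i j) W hij)) (sE i j (opre_sub (@U2l i j)) (opre_sub (@U2r i j))).
      rewrite resZ (res_comp _ _ (opre_sub hi)) (res_comp _ _ (opre_sub hj)) => ->.
      by rewrite wE lin_res (res_comp _ _ hi).
    rewrite tE (lin_scale _ _ (axi_tsec hi hj hij)) sjE scalerA linM phE.
    rewrite ME mulmatE /G0 mx2M map_mx2 mx2_mulcv.
    have FE : Fval (res hi (agen U i)) (res hi (agen U i)) = r (Fl i j).
      by rewrite -(res_comp (@U2l i j) hij hi) Fval_res Fval_tl.
    rewrite FE /r !oresD !oresM !ores0 !ores1; congr cv2; ring.
  have [a [c tE]] := ph_ex i W h t.
  rewrite MAE tE phE scalerA lin_tsec phE /M0 map_mx2 mx2_mulcv Fval_res.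
  by rewrite ores0 ores1 !mul0r mul1r add0r addr0 mulrC.
- split=> //; exists (Pair b MA); split; first by constructor.
  have id_lin (V : opens Y) : linear (fun t : sec (push f A) V => t) by [].
  have id_res (V W : opens Y) (h : W `<=` V) (t : sec (push f A) V) : res h t = res h t by [].
  exists (OHom id_lin id_res); split=> //.
  by exists (OHom id_lin id_res).
Qed.

(** * Transition functions read off a good representation *)

Section Representation.
Hypothesis finf : finite_morph f.
Hypothesis affgen : forall (A : omod X) (Z : opens X) x, line_bundle A ->
  is_affine Z -> Z x -> exists s : sec A Z, gen_at s x.
Variables (A : omod X) (p : pair D) (G : gluing U) (a0 a1 a2 : forall i, oring (U i)).
Hypothesis assocA : associated A p.
Hypothesis repA : is_rep p G (fun i => mx2 (a0 i) (a2 i) (a1 i) (- a0 i)).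
Hypothesis a1_unit : forall i, is_ounit (a1 i).

Local Notation b0 i j := (resl j (a0 i)).
Local Notation b1 i j := (resl j (a1 i)).
Local Notation alpha i j := (b1 i j * G i j 0 0 - b0 i j * G i j 1 0).

(** The first clause gives a_i1 u_ij as an element alpha + g21 t_i; the third evaluates its norm,
    alpha^2 - g21^2 F_i, and is what the inverse cocycle relies on. *)
Lemma rep_frame : exists u, frame A u /\ forall i j,
  [/\ opull f (b1 i j) * u i j = lin (tl i j) (alpha i j) (G i j 1 0),
      is_ounit (\det (G i j)) &
      b1 i j * \det (G i j) * ores (@U2r i j) (a1 j) =
      axi U i j * (alpha i j * alpha i j - G i j 1 0 * G i j 1 0 * Fl i j)].
Proof.
have [lineA [_ [[T b MA _ MAE] [Psi [[Phi [PhiK PsiK]] PsiE]]]]] := assocA.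
have [phi [phiG phiM]] := repA.
rewrite /= in Psi Phi PhiK PsiK PsiE.
(* The coordinates over U_i of a section of A, through the equivalence [Psi] of pairs. *)
pose chi i W (h : W `<=` U i) (t : sec A (opre f W)) := phi i W h (Psi W t).
have chiD i W (h : W `<=` U i) t t' : chi i W h (t + t') = chi i W h t + chi i W h t'.
  by rewrite /chi -trivD; congr (phi i W h _); exact: (ohomD Psi t t').
have chiZ i W (h : W `<=` U i) c t : chi i W h (opull f c *: t) = c *: chi i W h t.
  by rewrite /chi -trivZ; congr (phi i W h _); exact: (ohomZ Psi c t).
have chi_inj i W (h : W `<=` U i) t t' : chi i W h t = chi i W h t' -> t = t'.
  by move=> /(bij_inj (triv_bij (phi i) h)) /(congr1 (Phi W)); rewrite !PhiK.
have chi_sur i W (h : W `<=` U i) v : exists t, chi i W h t = v.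
  have [g _ gK] := triv_bij (phi i) h; exists (Phi W (g v)).
  by rewrite /chi PsiK gK.
have chi_res i V W (h : V `<=` U i) (h' : W `<=` V) (h'' : W `<=` U i) t :
    chi i W h'' (res (opre_sub h') t) = map_mx (ores h') (chi i V h t).
  rewrite -(triv_res (phi i) h h' h''); congr (phi i W h'' _).
  exact: (ohom_res Psi h' t).
pose Mm i W (h : W `<=` U i) := map_mx (ores h) (mx2 (a0 i) (a2 i) (a1 i) (- a0 i)).
have chi_tt i W (h : W `<=` U i) t :
    chi i W h (tsec (res h (agen U i)) *: t) = Mm i W h *m chi i W h t.
  by rewrite -phiM -PsiE -MAE.
have chiG i j t : chi i _ (@U2l i j) t = G i j *m chi j _ (@U2r i j) t.
  rewrite /chi (phiG i j _ _ (@U2r i j) (fun x => id)); congr (_ *m _).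
  by apply/matrixP => k l; rewrite mxE ores_id.
have hid i : U i `<=` U i by [].
have /(_ _)/cid s i : exists t, chi i _ (hid i) t = cv2 1 0 by exact: chi_sur.
pose se i := projT1 (s i).
have seE i W (h : W `<=` U i) : chi i W h (res (opre_sub h) (se i)) = cv2 1 0.
  rewrite (chi_res i _ _ (hid i)) (projT2 (s i)).
  by apply/matrixP => k l; rewrite !mxE; case: (k == 0); rewrite ?ores1 ?ores0.
have MmE i W (h : W `<=` U i) x y : Mm i W h *m cv2 x y =
    cv2 (ores h (a0 i) * x + ores h (a2 i) * y) (ores h (a1 i) * x - ores h (a0 i) * y).
  by rewrite /Mm map_mx2 mx2_mulcv oresN mulNr.
have chi_lin i W (h : W `<=` U i) x y :
    chi i W h (lin (res h (agen U i)) x y *: res (opre_sub h) (se i)) =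
    cv2 (x + y * ores h (a0 i)) (y * ores h (a1 i)).
  rewrite /lin scalerDl -scalerA chiD !chiZ chi_tt seE MmE !cv2Z cv2D.
  by congr cv2; ring.
have gs i : is_gen (se i).
  apply: (push_gen finf affgen) => // W h t.
  have [d dE] := ounit_res h (a1_unit i).
  have tE := cv2P (chi i W h t); set x := chi i W h t 0 0 in tE; set y := chi i W h t 1 0 in tE.
  (* With s_i of coordinates (1, 0), the section t_i s_i has coordinates (a_i0, a_i1). This
     triangular change of basis is solved for (x, y) by inverting a_i1: goodness enters here. *)
  exists (lin (res h (agen U i)) (x - y * d * ores h (a0 i)) (y * d)).
  apply: (chi_inj i W h); rewrite chi_lin tE; congr cv2; first by ring.
  by rewrite -mulrA (mulrC d) dE mulr1.
have /(_ _ _)/cid u i j : exists u, res (opre_sub (@U2r i j)) (se j) =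
    u *: res (opre_sub (@U2l i j)) (se i) by exact: gen_ex.
have uE i j := projT2 (u i j).
exists (fun i j => projT1 (u i j)); split.
  exists se; split=> // i j hi hj.
  by rewrite (res_irr hi (opre_sub (@U2l i j))) (res_irr hj (opre_sub (@U2r i j))).
move=> i j; set v := projT1 (u i j); have {}uE := uE i j; rewrite -/v in uE.
have blE (c : oring (U i)) : ores (@U2l i j) c = resl j c.
  by congr (ores _ _); exact: Prop_irrelevance.
have chi_sj : chi i _ (@U2l i j) (res (opre_sub (@U2r i j)) (se j)) =
    cv2 (G i j 0 0) (G i j 1 0).
  by rewrite chiG seE mulmx_cv2 !mulr1 !mulr0 !addr0.
have [al [be vE]] := lin_ex (gen_res (@U2l i j) (@gen_U i)) v.
have [e1 e2] : al + be * b0 i j = G i j 0 0 /\ be * b1 i j = G i j 1 0.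
  by apply: cv2_inj; rewrite -chi_sj uE vE chi_lin !blE.
(* Multiplying s_i twice by t_i and comparing first coordinates yields F_i = a_i0^2 + a_i1 a_i2. *)
have FE : Fl i j = b0 i j * b0 i j + resl j (a2 i) * b1 i j.
  have := chi_tt i _ (@U2l i j) (tsec (tl i j) *: res (opre_sub (@U2l i j)) (se i)).
  rewrite [X in _ *m X]chi_tt scalerA tsec_sqr chiZ seE cv2Z !MmE !blE Fval_tl.
  rewrite !mulr1 !mulr0 !addr0 ?subr0 => e; by have [] := cv2_inj e.
split.
- rewrite vE /lin mulrDr mulrA -!opullM; congr (opull f _ + opull f _ * _).
    by rewrite -e1 -e2; ring.
  by rewrite mulrC.
- have [t1 t1E] := chi_sur i _ (@U2l i j) (cv2 1 0).
  have [t2 t2E] := chi_sur i _ (@U2l i j) (cv2 0 1).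
  have := t1E; have := t2E; rewrite !chiG.
  rewrite [chi j _ _ t1]cv2P [chi j _ _ t2]cv2P !mulmx_cv2.
  set x := chi j _ _ t1 0 0; set y := chi j _ _ t1 1 0.
  set z := chi j _ _ t2 0 0; set w := chi j _ _ t2 1 0.
  move=> e3 e4; have [q1 q2] := cv2_inj e3; have [q3 q4] := cv2_inj e4.
  (* The j-coordinates of the sections whose i-coordinates are the standard basis form the inverse
     of G_ij; this is its determinant. *)
  exists (x * w - y * z).
  rewrite det2.
  rewrite (_ : _ * _ = (G i j 0 0 * x + G i j 0 1 * y) * (G i j 1 0 * z + G i j 1 1 * w) -
    (G i j 0 0 * z + G i j 0 1 * w) * (G i j 1 0 * x + G i j 1 1 * y)); last by ring.
  by rewrite q1 q2 q3 q4 mulr1 mulr0 subr0.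
(* Computing t_j s_j in both frames gives the first column of G_ij M_j = xi_ij M_i G_ij. Cramer's
   rule then eliminates a_j0 and leaves det(G_ij) a_j1. *)
- have := chiG i j (tsec (res (@U2r i j) (agen U j)) *: res (opre_sub (@U2r i j)) (se j)).
  rewrite chi_tt seE MmE mulmx_cv2.
  rewrite (axi_tsec (@U2l i j) (@U2r i j) (fun x => id)) ores_id -scalerA chiZ chi_tt chi_sj.
  rewrite MmE cv2Z !blE !mulr1 !mulr0 !addr0 subr0 => e; have [q1 q2] := cv2_inj e.
  rewrite det2 FE.
  transitivity (b1 i j * (G i j 0 0 * (G i j 1 0 * ores (@U2r i j) (a0 j) + G i j 1 1 * ores (@U2r i j) (a1 j))
    - G i j 1 0 * (G i j 0 0 * ores (@U2r i j) (a0 j) + G i j 0 1 * ores (@U2r i j) (a1 j)))); first by ring.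
  by rewrite -q1 -q2; ring.
Qed.

(** For a nonnegative exponent the cocycle is a power of u_ij, and dividing by a_i1 turns the first
    clause of [rep_frame] into [Kplus]. For a negative one it is a power of the cocycle [v] of the
    inverse bundle. *)
Lemma Kn_frame n B : tensor_zexp A n B -> exists w, frame B w /\
  forall i j, mulmat (Kn G a0 a1 n i j ^+ `|n|%N) (w i j).
Proof.
have [u [fA uP]] := rep_frame.
have b1_unit i j : is_ounit (b1 i j) by apply: ounit_res.
case: n => n /=.
  move=> /(frame_exp fA) fB; exists (fun i j => u i j ^+ n); split=> // i j.
  apply: mulmatX; have [uE _ _] := uP i j; have := ounit_oinv (b1_unit i j).
  rewrite /Kn /= /Kplus /=; set c := Defs.oinv _ => cE.
  exists (c * alpha i j), (c * G i j 1 0); split.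
    by rewrite scalerDr !scalerA.
  transitivity (opull f c * (opull f (b1 i j) * u i j)).
    by rewrite mulrA -opullM mulrC [c * _]mulrC cE opull1 mulr1.
  by rewrite uE /lin !opullM; ring.
move=> [B' [invB /=]].
pose c i j := axi U i j * Defs.oinv (b1 i j * \det (G i j)).
(* The conjugate of a_i1 u_ij, scaled by xi_ij / (a_i1 det(G_ij)) so that the norm identity gives
   v_ij u_ij a_i1 = a_j1, the relation that [frame_inverse] asks for. *)
pose v : transition := fun i j => lin (tl i j) (c i j * alpha i j) (- (c i j * G i j 1 0)).
have fB' : frame B' v.
  apply: (frame_inverse (a := fun i => opull f (a1 i)) fA invB).
    by move=> i; have [d dE] := a1_unit i; exists (opull f d); rewrite -opullM dE opull1.
  move=> i j hi hj; have [uE du nE] := uP i j.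
  have opE k (hk : opre f (U2 i j) `<=` opre f (U k)) (h : U2 i j `<=` U k) :
      ores hk (opull f (a1 k)) = opull f (ores h (a1 k)).
    by rewrite opull_res; congr (ores _ _); exact: Prop_irrelevance.
  rewrite (opE _ hi (@subIsetl _ _ _)) (opE _ hj (@U2r i j)).
  rewrite -mulrA [u i j * _]mulrC uE linM Fval_tl.
  have := ounit_oinv (ounitM (b1_unit i j) du); set e := Defs.oinv _ => eE.
  (* In the product of conjugates the coefficient of t_i cancels and only the norm remains. *)
  rewrite /lin [X in opull f X * _](_ : _ = 0); last by ring.
  rewrite opullZ0 mul0r addr0; congr (opull f _).
  transitivity (e * (axi U i j * (alpha i j * alpha i j - G i j 1 0 * G i j 1 0 * Fl i j))).
    by rewrite /c -/e; ring.
  by rewrite -nE mulrA [e * _]mulrC eE mul1r.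
move=> [P [fP tP]].
have fB : frame B (fun i j => v i j ^+ n.+1).
  by apply: (frame_exp fB'); exists P.
exists (fun i j => v i j ^+ n.+1); split=> // i j; apply: mulmatX.
exists (c i j * alpha i j), (- (c i j * G i j 1 0)); split=> //.
by rewrite /Kn /= /Kminus -/(c i j) scalerBr !scalerA scaleNr.
Qed.

End Representation.

End Frames.
End DoubleCover.

Theorem theorem3p1 (R : realType) (X Y : fspace R[i]) (phi : fmorph X Y)
  (hphi : nonsingular_double_cover phi) (D : cover_data phi)
  (I : Type) (U : adapted_cover D I)
  (m : nat) (p : 'I_m -> pair D) (hp : forall k, admissible (p k))
  (G : 'I_m -> gluing U) (a0 a1 a2 : 'I_m -> forall i, oring (U i))
  (hrep : forall k,
     is_rep (p k) (G k) (fun i => mx2 (a0 k i) (a2 k i) (a1 k i) (- a0 k i)))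
  (hgood : forall k i, is_ounit (a1 k i))
  (L : 'I_m -> omod X) (hL : forall k, associated (L k) (p k))
  (n : 'I_m -> int) (Ln : omod X) (hLn : tensor_monomial L n Ln) :
  exists q : pair D,
    [/\ admissible q, is_rep q (Gn G a0 a1 n) (M0 U) & associated Ln q].
Proof.
have [[[irrX _ _] _] _ finphi _ _] := hphi.
have affgen (A : omod X) (Z : opens X) x : line_bundle A ->
    is_affine Z -> Z x -> exists s : sec A Z, gen_at s x.
  exact: (@line_bundle_globally_generated R[i] X A Z x (@uncountable_complex R) irrX).
have [B [BL prodB]] := hLn.
have /(_ _)/cid w k := Kn_frame finphi affgen (hL k) (hrep k) (hgood k) (BL k).
have frameLn := frame_prod (fun k => (projT2 (w k)).1) prodB.
by apply: (frame_pair frameLn) => i j; apply: mulmat_prod => k; exact: (projT2 (w k)).2.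
Qed.
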